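(* Let $N\geq 2$ be an integer and let $\mathcal{F}$ be an element of $\mathscr{F}(2;N)$. Then $\dim\mathcal{O}(\mathcal{F})\geq 6$.
   Context: $\mathscr{F}(2;N)$ is the set of foliations of degree $N$ on $\mathbb{P}^2(\mathbb{C})$: such a foliation is given, up to a nonzero scalar, by a homogeneous $1$-form $\omega=a\,\mathrm{d}X+b\,\mathrm{d}Y+c\,\mathrm{d}Z$ on $\mathbb{C}^3$ with $a,b,c$ homogeneous polynomials of degree $N+1$ without common factor and $aX+bY+cZ=0$. It is a Zariski open subset of a projective space. $\mathrm{Aut}(\mathbb{P}^2(\mathbb{C}))=\mathrm{PGL}_3(\mathbb{C})$ acts on $\mathscr{F}(2;N)$ by pullback, and $\mathcal{O}(\mathcal{F})$ is the orbit of $\mathcal{F}$. Dimensions are complex dimensions. *)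

(* Defs.v *)
From HB Require Import structures.
From mathcomp Require Import all_boot all_order all_algebra.
From mathcomp Require Import complex mpoly.
From mathcomp Require Import boolp classical_sets reals constructive_ereal ereal.

Set Implicit Arguments.
Unset Strict Implicit.
Unset Printing Implicit Defensive.

Import GRing.Theory.

Local Open Scope ring_scope.
Local Open Scope classical_set_scope.

Section KrullDimension.
Context {T : Type} (closed_set : set (set T)).

Definition closed_in (Y Z : set T) : Prop :=
  exists2 C, closed_set C & Z = Y `&` C.

Definition irreducible (Z : set T) : Prop :=
  Z !=set0 /\
  forall A B, closed_set A -> closed_set B ->
    Z `<=` A `|` B -> Z `<=` A \/ Z `<=` B.

Definition irreducible_chain (Y : set T) (n : nat) (Z : nat -> set T) : Prop :=
  (forall k, (k <= n)%N -> closed_in Y (Z k) /\ irreducible (Z k)) /\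
  (forall k, (k < n)%N -> Z k `<` Z k.+1).

(* The dimension of Y for the topology induced on it, with dim set0 = -oo. *)
Definition krull_dim (R : realType) (Y : set T) : \bar R :=
  ereal_sup [set n%:R%:E | n in [set n | exists Z, irreducible_chain Y n Z]].

End KrullDimension.

Section Zariski.
Context {K : fieldType} {V : vectType K}.

Definition projective_space : Type := {L : {vspace V} | \dim L == 1%N}.

(* A linear change of coordinates preserves homogeneity, so the closed sets do
   not depend on the choice of a basis of V. *)
Definition vanishing_locus (S : set {mpoly K[\dim {:V}]}) : set projective_space :=
  [set L : projective_space | forall p, S p ->
     forall v : V, v \in sval L -> p.@[fun i => coord (vbasis {:V}) i v] = 0].

Definition zariski_closed (Z : set projective_space) : Prop :=
  exists2 S : set {mpoly K[\dim {:V}]},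
    (forall p, S p -> p \is homog mdeg) & Z = vanishing_locus S.

End Zariski.

Arguments projective_space {K} V.

(* The 1-form a dX + b dY + c dZ, with homogeneous coefficients of degree d,
   is the family (a, b, c). *)
Notation one_form K d := {ffun 'I_3 -> dhomog 3 K d}.

Section Foliations.
Context {K : fieldType}.

Definition no_common_factor d (w : one_form K d) : Prop :=
  forall p : {mpoly K[3]},
    (forall i, exists q : {mpoly K[3]}, (w i : {mpoly K[3]}) = q * p) ->
    (msize p <= 1)%N.

Definition euler_contraction d (w : one_form K d) : {mpoly K[3]} :=
  \sum_(i < 3) (w i : {mpoly K[3]}) * 'X_i.

Definition foliations (N : nat) : set (projective_space (one_form K N.+1)) :=
  [set F | exists w : one_form K N.+1,
     [/\ sval F = <[w]>%VS, no_common_factor w & euler_contraction w = 0]].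

Definition linear_map (A : 'M[K]_3) : 3.-tuple {mpoly K[3]} :=
  [tuple \sum_(k < 3) A i k *: 'X_k | i < 3].

(* Coefficient of dX_j in the pullback by x |-> A x, under which X_i becomes
   \sum_k A i k *: X_k and dX_i becomes \sum_j A i j *: dX_j. *)
Definition pullback_coef (A : 'M[K]_3) d (w : one_form K d) (j : 'I_3) :
    {mpoly K[3]} :=
  \sum_(i < 3) A i j *: ((w i : {mpoly K[3]}) \mPo linear_map A).

Lemma comp_linear_map_homog (A : 'M[K]_3) d (p : {mpoly K[3]}) :
  p \is d.-homog -> p \mPo linear_map A \is d.-homog.
Proof.
move=> /dhomogP hp; rewrite comp_mpolyEX big_seq.
apply: rpred_sum => m /hp hm; rewrite comp_mpolyX; apply: dhomogZ.
have -> : d = (\sum_(i < 3) m i)%N by rewrite -hm /= mdegE.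
elim/big_rec2: _ => [|i e q _ hq]; first exact: dhomog1.
apply: dhomogM hq; rewrite tnth_mktuple.
rewrite -[X in X.-homog](mul1n (m i)); apply: dhomogMn.
by apply: rpred_sum => k _; apply: dhomogZ; rewrite dhomogX /= mdeg1.
Qed.

Lemma pullback_coef_homog (A : 'M[K]_3) d (w : one_form K d) j :
  pullback_coef A w j \is d.-homog.
Proof.
apply: rpred_sum => i _; apply: dhomogZ; apply: comp_linear_map_homog.
exact: dhomog_is_dhomog.
Qed.

Definition pullback (A : 'M[K]_3) d (w : one_form K d) : one_form K d :=
  [ffun j => DHomog (pullback_coef_homog A w j)].

Lemma pullback_is_linear (A : 'M[K]_3) d : linear (@pullback A d).
Proof.
move=> c u v; apply/ffunP => j; rewrite !ffunE; apply: val_inj => /=.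
rewrite /pullback_coef scaler_sumr -big_split; apply: eq_bigr => i _ /=.
by rewrite !ffunE /= linearP scalerDr !scalerA mulrC.
Qed.

HB.instance Definition _ (A : 'M[K]_3) d :=
  GRing.isLinear.Build K (one_form K d) (one_form K d) *:%R
    (@pullback A d) (@pullback_is_linear A d).

(* PGL_3 is represented by GL_3: by homogeneity scalar matrices act trivially
   on the lines of one_form K d. *)
Definition foliation_orbit d (F : projective_space (one_form K d)) :
    set (projective_space (one_form K d)) :=
  [set G | exists2 A : 'M[K]_3,
     A \in unitmx & sval G = (linfun (@pullback A d) @: sval F)%VS].

End Foliations.

Arguments foliations {K} N.

(* Main.v *)
From HB Require Import structures.
Require Import Defs.
From mathcomp Require Import all_boot all_order all_algebra.
From mathcomp Require Import complex mpoly spectral.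
From mathcomp Require Import boolp classical_sets reals constructive_ereal ereal.
From mathcomp Require Import ring zify.

Set Implicit Arguments.
Unset Strict Implicit.
Unset Printing Implicit Defensive.

Import Order.TTheory GRing.Theory Num.Theory.
Local Open Scope ring_scope.

(** The orbit of [F] has dimension [8 - dim Aut F], so the point is that the
    infinitesimal symmetries of a foliation of degree at least two form a Lie
    algebra of dimension at most two, and that this bounds from below the
    length of a chain of irreducible closed subsets of the orbit.

    Infinitesimal symmetries. Let [w] define [F] and let [g] be the Lie algebra
    of the matrices [B] such that the Lie derivative of [w] along [x |-> B x]
    vanishes; scalar matrices scale [w], so [g] is a copy of the Lie algebra of
    [Aut F] in the quotient of [gl_3] by the scalars. Put [f_B = w (B x)]. If
    [f_B = 0], then [w] is colinear with the cross product of [x] and [B x],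
    which is quadratic; as the coefficients of [w] are coprime of degree
    [N + 1 > 2], unique factorization makes [B] scalar
    ([contraction_eq0_scalar]). So [B |-> f_B] is injective on [g]. Since [w]
    is integrable, Cartan's formula gives
    [f_A df_B - f_B df_A = - f_[A,B] w] ([wronskian_contraction]). Therefore
    commuting elements of [g] have proportional [f], hence are proportional.
    A Lie algebra with this property and of dimension at least three contains
    [Y], [T], [S] with [[Y,T] = Y], [[Y,S] = T], [[T,S] = S]
    ([exists_sl2_triple]), and the same formula then yields
    [f_T ^ 2 = 2 f_S f_Y] ([isotropic_sl2_relation]).

    Such a copy of [sl_2] acts on the space of dimension three either with
    [Y ^ 2 = 0], as the sum of the standard and the trivial representations, or
    irreducibly. In the first case the relation says that [w] annihilates
    [T ^ 2 x], which is excluded as above because [T ^ 2] is not scalar. In the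
    second case it makes [w] isotropic for the invariant quadratic form on
    covectors; together with [w x = 0] this would make the discriminant, the
    invariant quadratic form in [x], a square ([no_sl2_relation]).

    Dimension of the orbit. The differential at the identity of
    [A |-> pullback A w] is the Lie derivative, so its rank is at least
    [9 - 2 = 7]. Choose seven matrices, beginning with the identity, with
    independent Lie derivatives, and let [Z_k] be the closure in the orbit of
    the images of [F] under the span of the first [k + 1]. It is irreducible, as
    the closure of the image of an open subset of a linear space. The inclusion
    of [Z_k] in [Z_(k+1)] is strict ([flag_separating]): among [k + 2] suitable
    coordinates of the pullback there is an algebraic relation on the span of
    [k + 1] matrices, because there are more monomials in [k + 2] variables than
    in [k + 1] ([forms_dependent]), but none on the span of [k + 2], by the
    Jacobian criterion ([jacobian_independent]). *)

(** * Unique factorization in polynomial rings *)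

Section Factorial.
Context {R : idomainType}.
Implicit Types (a b c p : R) (s : seq R).

(** Divisibility and primes are stated without reference to units, so that they
    can be transported along a multiplicative bijection. *)
Definition divides a b := exists c, b = c * a.

Definition prime_elt p :=
  [/\ p != 0, ~ divides p 1
    & forall a b, divides p (a * b) -> divides p a \/ divides p b].

Lemma divides_mull a b c : divides a b -> divides a (c * b).
Proof. by case=> d ->; exists (c * d); rewrite mulrA. Qed.

Lemma divides_add a b c : divides a b -> divides a c -> divides a (b + c).
Proof. by case=> d -> [e ->]; exists (d + e); rewrite mulrDl. Qed.

Lemma divides_sub a b c : divides a b -> divides a (b + c) -> divides a c.
Proof.
by case=> d -> [e he]; exists (e - d); rewrite mulrBl -he addrAC subrr add0r.
Qed.

Lemma divides0 a : divides a 0. Proof. by exists 0; rewrite mul0r. Qed.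

Definition all_prime s := forall p, p \in s -> prime_elt p.

Definition prime_factorization a :=
  exists s u, [/\ all_prime s, divides u 1 & a = u * \prod_(p <- s) p].

Lemma prime_factorizationM a b :
  prime_factorization a -> prime_factorization b -> prime_factorization (a * b).
Proof.
move=> [s [u [hs [u' hu] ->]]] [t [v [ht [v' hv] ->]]].
exists (s ++ t), (u * v); split.
- by move=> p; rewrite mem_cat => /orP[/hs|/ht].
- by exists (u' * v'); rewrite mulrACA -hu -hv mulr1.
- by rewrite big_cat mulrACA.
Qed.

Lemma prime_factorization_prime p : prime_elt p -> prime_factorization p.
Proof.
move=> hp; exists [:: p], 1; split.
- by move=> q; rewrite inE => /eqP ->.
- by exists 1; rewrite mulr1.
- by rewrite big_seq1 mul1r.
Qed.

Lemma prime_divides_prod p s :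
  prime_elt p -> divides p (\prod_(q <- s) q) ->
  exists2 q, q \in s & divides p q.
Proof.
move=> hp; elim: s => [|q s ih]; first by rewrite big_nil; case: hp.
rewrite big_cons; case: hp ih => _ _ hp ih /hp [h|/ih [r hr h]].
  by exists q; rewrite ?mem_head.
by exists r; rewrite ?inE ?hr ?orbT.
Qed.

(** The strict decrease of the number of primes makes the extraction of the
    primes dividing all the coefficients of a polynomial terminate. *)
Lemma prime_factorization_cancel p b s u :
  prime_elt p -> all_prime s -> divides u 1 -> u * \prod_(q <- s) q = b * p ->
  exists t v, [/\ all_prime t, divides v 1, b = v * \prod_(q <- t) q
                & (size t < size s)%N].
Proof.
move=> hp hs [u' hu] e.
have [p0 p1 pM] := hp.
have [q qs [c qE]] : exists2 q, q \in s & divides p q.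
  apply: prime_divides_prod => //.
  have: divides p (u * \prod_(q <- s) q) by exists b.
  case/pM => // -[c uE]; case: p1; exists (u' * c).
  by rewrite hu uE; ring.
have [q0 q1 qM] := hs q qs.
have [d hd] : divides c 1.
  have: divides q (c * p) by exists 1; rewrite qE mul1r.
  case/qM => -[d dE].
  - case: p1; exists d; apply: (mulfI q0); rewrite mulr1 {1}qE dE.
    by ring.
  - exists d; apply: (mulfI p0).
    by rewrite mulr1 {1}dE qE; ring.
exists (rem q s), (u * c); split.
- by move=> r /mem_rem /hs.
- by exists (u' * d); rewrite mulrACA -hu -hd mulr1.
- apply: (mulIf p0); rewrite -e (perm_big _ (perm_to_rem qs)) big_cons.
  move: (\prod_(j <- _) j) => P; rewrite qE.
  by rewrite /=; ring.
- by rewrite size_rem // ltn_predL; case: (s) qs.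
Qed.

(** Each prime factor of [w i0] misses some [w i], so it divides [v i0] and can
    be cancelled. *)
Lemma primitive_colinear (I : finType) (v w : I -> R) (i0 : I) :
  prime_factorization (w i0) ->
  (forall p, prime_elt p -> exists i, ~ divides p (w i)) ->
  (forall i j, w i * v j = w j * v i) -> w i0 != 0 ->
  exists q, forall i, v i = q * w i.
Proof.
move=> [s [u [hs [u' hu] e]]] prim hvw w0.
have H : forall d, (forall j, \prod_(p <- s) p * v j = w j * d) ->
    exists b, d = \prod_(p <- s) p * b.
  elim: s hs {e} => [|p s ih] hs d hd; first by exists d; rewrite big_nil mul1r.
  have hp : prime_elt p by apply: hs; rewrite mem_head.
  have [p0 _ pM] := hp.
  have [i hi] := prim p hp.
  have [c hc] : divides p d.
    have: divides p (w i * d).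
      by exists (\prod_(q <- s) q * v i); rewrite -hd big_cons; ring.
    by case/pM.
  have [r hr|j|b hb] := ih _ c.
  - by apply: hs; rewrite inE hr orbT.
  - by apply: (mulfI p0); have := hd j; rewrite big_cons hc => hj; ring: hj.
  - by exists b; rewrite big_cons hc hb; ring.
have [j|b hb] := H (u' * v i0).
  rewrite [RHS]mulrCA -hvw e.
  transitivity ((u' * u) * (\prod_(p <- s) p * v j)); last by ring.
  by rewrite -hu mul1r.
exists b => j; apply: (mulfI w0); rewrite hvw.
have -> : v i0 = w i0 * b.
  by rewrite e -mulrA -hb mulrA [u * _]mulrC -hu mul1r.
by ring.
Qed.
End Factorial.

Section PolyFactorial.
Context {R : idomainType} (fR : forall a : R, a != 0 -> prime_factorization a).
Implicit Types (c p : R) (f g h : {poly R}).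

Lemma divides_polyCP p f : divides p%:P f <-> forall i, divides p f`_i.
Proof.
split=> [[g ->] i|/choice [c hc]].
  by exists g`_i; rewrite coefMC.
exists (\poly_(i < size f) c i); apply/polyP => i.
rewrite coefMC coef_poly; case: ltnP => [_|hi]; first exact: hc.
by rewrite nth_default // mul0r.
Qed.

(** Gauss: the lowest coefficients not divisible by [p] have a product that
    is the only term of its degree not divisible by [p]. *)
Lemma prime_polyC p : prime_elt p -> prime_elt p%:P.
Proof.
move=> [p0 p1 pM]; split.
- by rewrite polyC_eq0.
- by case=> g /(congr1 (fun f => f`_0)); rewrite coefMC coef1 => h; case: p1; exists g`_0.
move=> f g hfg; apply: contrapT => /not_orP [].
have low h : ~ divides p%:P h ->
    exists2 i, ~ divides p h`_i & forall j, (j < i)%N -> divides p h`_j.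
  move=> hh; have ex : exists i, ~~ `[< divides p h`_i >].
    apply: contrapT => hn; apply: hh; apply/divides_polyCP => i.
    by apply: contrapT => hi; apply: hn; exists i; apply/asboolPn.
  case: (ex_minnP ex) => i /asboolPn hi' hmin; exists i => // j hj.
  apply: contrapT => hn; have := hmin j; rewrite leqNgt hj.
  by move=> /(_ _)/negP; case => //; apply/asboolPn.
move=> /low [i hi hi'] /low [j hj hj'].
have := (divides_polyCP p (f * g)).1 hfg (i + j)%N.
have hlt : (i < (i + j).+1)%N by rewrite ltnS leq_addr.
rewrite coefM (bigD1 (Ordinal hlt)) //= addKn addrC => H.
have /pM [] // : divides p (f`_i * g`_j).
apply: divides_sub H; elim/big_rec: _ => [|k x /negP hk]; first exact: divides0.
apply: divides_add; case: (ltngtP k i) => hki.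
- by rewrite mulrC; apply: divides_mull; exact: hi'.
- apply: divides_mull; apply: hj'; have := ltn_ord k; lia.
- by case: hk; apply/eqP/val_inj.
Qed.

Definition primitive_poly f := forall p, prime_elt p -> ~ divides p%:P f.

Lemma primitive_part f : f != 0 ->
  exists s g, [/\ all_prime s, f = (\prod_(p <- s) p)%:P * g & primitive_poly g].
Proof.
move=> f0; have [t [u [ht hu e]]] : prime_factorization (lead_coef f).
  by apply: fR; rewrite lead_coef_eq0.
have [n] := ubnP (size t); elim: n => // n ih in f f0 t u ht hu e *.
rewrite ltnS => hn; have [hf|] := pselect (primitive_poly f).
  by exists [::], f; rewrite big_nil mul1r.
move=> /existsNP [p /not_implyP [hp /contrapT [g fE]]].
have g0 : g != 0 by apply: contraNneq f0 => g0; rewrite fE g0 mul0r.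
have lE : u * \prod_(q <- t) q = lead_coef g * p.
  by rewrite -e fE lead_coefM lead_coefC.
have [t' [v [ht' hv gE ltt]]] := prime_factorization_cancel hp ht hu lE.
have [|s [h [hs gE' hh]]] := ih g g0 t' v ht' hv gE; first exact: leq_trans hn.
exists (p :: s), h; split => //.
  by move=> q; rewrite inE => /orP [/eqP ->|/hs].
by rewrite fE gE' big_cons polyCM /=; ring.
Qed.

(** The primes of [c] remain prime among polynomials and do not divide [f], so
    they can be cancelled one at a time. *)
Lemma primitive_strip f g c : primitive_poly f -> c != 0 ->
  divides f (c%:P * g) -> divides f g.
Proof.
move=> hf /fR [s [u [hs [u' hu] ->]]] [h hE].
have {}hE : (\prod_(p <- s) p)%:P * g = (u'%:P * h) * f.
  rewrite -mulrA -hE [in RHS]polyCM; rewrite !mulrA -polyCM -hu polyC1; ring.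
elim: s hs {c} (_ * h) hE => [|p s ih] hs {}h; first by rewrite big_nil mul1r; exists h.
have hp : prime_elt p by apply: hs; rewrite mem_head.
rewrite big_cons /= polyCM => hE.
have [p0 _ /(_ h f)] := prime_polyC hp.
case=> [|[k hk]|/(hf p hp)//]; first by exists ((\prod_(j <- s) j)%:P * g); rewrite -hE; ring.
apply: (ih _ k) => [q hq|]; first by apply: hs; rewrite inE hq orbT.
by apply: (mulfI p0); rewrite mulrA hE hk; ring.
Qed.

(** Clearing denominators: each prime of [c] divides [g] or [h]. *)
Lemma primitive_factor f g h c : c != 0 -> c%:P * f = g * h ->
  exists g' h', [/\ f = g' * h', size g' = size g & size h' = size h].
Proof.
move=> /fR [s [u [hs [u' hu] ->]]] e.
have u0 : u != 0 by apply: contra_eq_neq hu => ->; rewrite mulr0 oner_neq0.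
have u'0 : u' != 0 by apply: contra_eq_neq hu => ->; rewrite mul0r oner_neq0.
have {}e : (\prod_(p <- s) p)%:P * f = (u'%:P * g) * h.
  rewrite -mulrA -e [in RHS]polyCM; rewrite !mulrA -polyCM -hu polyC1; ring.
have sg : size (u'%:P * g) = size g by rewrite size_Cmul.
suff [g' [h' []]] : exists g' h', [/\ f = g' * h', size g' = size (u'%:P * g)
    & size h' = size h] by rewrite sg; exists g', h'.
move: (u'%:P * g) e => k e {u u' hu u0 u'0 sg g}.
elim: s hs k h e => [|p s ih] hs k l.
  by rewrite big_nil mul1r => ->; exists k, l.
have hp : prime_elt p by apply: hs; rewrite mem_head.
have hs' : all_prime s by move=> q hq; apply: hs; rewrite inE hq orbT.
rewrite big_cons /= polyCM => hE.
have [p0 _ /(_ k l)] := prime_polyC hp.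
move: (p0); rewrite polyC_eq0 => p0'.
case=> [|[k' hk]|[l' hl]]; first by exists ((\prod_(j <- s) j)%:P * f); rewrite -hE; ring.
  have [|g' [h' [e1 e2 e3]]] := ih hs' k' l.
    by apply: (mulfI p0); rewrite mulrA hE hk; ring.
  by exists g', h'; split; rewrite // e2 hk mulrC size_Cmul.
have [|g' [h' [e1 e2 e3]]] := ih hs' k l'.
  by apply: (mulfI p0); rewrite mulrA hE hl; ring.
by exists g', h'; split; rewrite // e3 hl mulrC size_Cmul.
Qed.

(** Given [f] dividing [a * b], the polynomials [v] such that [f] divides
    [a * v] are stable under pseudo-division, so a nonzero one of least degree
    divides both [f] and [b] up to constants. By irreducibility it is constant,
    and then [f] divides [a], or has the degree of [f], and then [f] divides
    [b]. *)
Lemma irreducible_prime_poly f : f != 0 -> (1 < size f)%N -> primitive_poly f ->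
  (forall g h, f = g * h -> (size f <= size g)%N \/ (size f <= size h)%N) ->
  prime_elt f.
Proof.
move=> f0 sf hf irr; split=> //.
  case=> g; move/(congr1 (fun h : {poly R} => size h)); rewrite size_poly1 => e.
  have g0 : g != 0 by apply: contra_eq_neq e => ->; rewrite mul0r size_poly0.
  have := size_poly_gt0 g; rewrite g0; move: e; rewrite size_mul //; lia.
move=> a b hab; pose J v := divides f (a * v).
have ex : exists n, `[< exists v, [/\ v != 0, J v & size v = n] >].
  by exists (size f); apply/asboolP; exists f; split => //; exists a.
case: (ex_minnP ex) => n /asboolP [v [v0 Jv sv]] hmin.
have {}hmin w : w != 0 -> J w -> (size v <= size w)%N.
  by move=> w0 Jw; rewrite sv; apply: hmin; apply/asboolP; exists w.
have JvP w : J w -> exists2 c, c != 0 & exists q, c%:P * w = q * v.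
  move=> Jw; have := Pdiv.Idomain.divp_eq w v; set c := _ ^+ _ => e.
  have c0 : c != 0 by rewrite expf_neq0 // lead_coef_eq0.
  exists c => //; exists (w %/ v); rewrite mul_polyC e.
  suff /eqP -> : w %% v == 0 by rewrite addr0.
  apply/negPn/negP => r0; have := hmin _ r0; rewrite leqNgt ltn_modp v0.
  suff h : J (w %% v) by move=> /(_ h).
  have : J (c%:P * w).
    by rewrite /J mulrCA; apply: divides_mull.
  rewrite mul_polyC e /J mulrDr; apply: divides_sub.
  by rewrite mulrCA; apply: divides_mull.
have [c c0 [q e]] := JvP f (ex_intro _ a erefl).
have [q' [v' [fE _ sv']]] := primitive_factor c0 e.
have q'0 : q' != 0 by apply: contraNneq f0 => z; rewrite fE z mul0r.
have v'0 : v' != 0 by apply: contraNneq f0 => z; rewrite fE z mulr0.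
have [hq|hv] := irr _ _ fE.
  left; have : size v = 1%N.
    move: hq; rewrite fE size_mul // sv'; have := v0; rewrite -size_poly_gt0; lia.
  move=> /eqP/size_poly1P [d d0 vE].
  by apply: (@primitive_strip _ _ d) => //; rewrite mulrC -vE.
right; have [d d0 [r e']] := JvP b hab.
have fJ : J f by exists a.
have sfv : size v = size f.
  by apply/eqP; rewrite eqn_leq hmin //= -sv'.
have : size q' = 1%N.
  move: sfv; rewrite fE -sv' size_mul //.
  by have := v'0; rewrite -size_poly_gt0; have := q'0; rewrite -size_poly_gt0; lia.
have : size q = 1%N.
  have q0 : q != 0.
    apply: contraNneq f0 => z; move: e; rewrite z mul0r => /eqP.
    by rewrite mulf_eq0 polyC_eq0 (negPf c0).
  have : size (c%:P * f) = size (q * v) by rewrite e.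
  rewrite size_Cmul // size_mul // sfv => h.
  have := q0; rewrite -size_poly_gt0; lia.
move=> /eqP/size_poly1P [k k0 qE] _.
apply: (@primitive_strip _ _ (k * d)) => //; first by rewrite mulf_neq0.
exists (c%:P * r); rewrite polyCM -mulrA e'.
by rewrite mulrCA -qE -e; ring.
Qed.

(** Split off the primes of [R], then decompose by decreasing degree; the pieces
    that do not decompose further are prime. *)
Theorem poly_factorial f : f != 0 -> prime_factorization f.
Proof.
have cst c : c != 0 -> prime_factorization c%:P.
  move=> /fR [s [u [hs [u' hu] ->]]]; rewrite polyCM rmorph_prod /=.
  exists [seq p%:P | p <- s], u%:P; split.
  - by move=> _ /mapP [p /hs hp ->]; exact: prime_polyC.
  - by exists u'%:P; rewrite -polyCM -hu.
  - by rewrite big_map.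
have [n] := ubnP (size f); elim: n => // n ih in f *; rewrite ltnS => hn f0.
have [s [g [hs fE hg]]] := primitive_part f0.
have g0 : g != 0 by apply: contraNneq f0 => z; rewrite fE z mulr0.
have s0 : \prod_(p <- s) p != 0.
  by apply: contraNneq f0 => z; rewrite fE z mul0r.
have sg : size g = size f by rewrite fE size_Cmul.
rewrite fE; apply: prime_factorizationM; first exact: cst.
have [/size1_polyC ge|sg1] := leqP (size g) 1.
  by move: g0; rewrite ge polyC_eq0 => /cst.
have [|] := pselect (forall k h, g = k * h ->
    (size g <= size k)%N \/ (size g <= size h)%N).
  by move=> irr; apply: prime_factorization_prime; exact: irreducible_prime_poly.
move=> /existsNP [k /existsNP [h /not_implyP [gE /not_orP [hk hh]]]].
move/negP: hk; move/negP: hh; rewrite -!ltnNge => hh hk.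
have k0 : k != 0 by apply: contraNneq g0 => z; rewrite gE z mul0r.
have h0 : h != 0 by apply: contraNneq g0 => z; rewrite gE z mulr0.
by rewrite gE; apply: prime_factorizationM; apply: ih => //; lia.
Qed.
End PolyFactorial.

(** * Multivariate polynomials *)

Section MPolyBasics.
Context {n : nat} {R : comNzRingType}.
Implicit Types (p q : {mpoly R[n]}).

Lemma mpoly_ring_ind (P : {mpoly R[n]} -> Prop) :
  (forall c, P c%:MP) -> (forall i, P 'X_i) ->
  (forall p q, P p -> P q -> P (p + q)) ->
  (forall p q, P p -> P q -> P (p * q)) -> forall p, P p.
Proof.
move=> hC hX hD hM; elim/mpolyind => [|c m p _ _ hp]; first by rewrite -mpolyC0.
apply: (hD) => //; rewrite -mul_mpolyC; apply: (hM) => //; rewrite mpolyXE_id.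
elim/big_rec: _ => [|i q _ hq]; first by rewrite -mpolyC1.
by apply: (hM) => //; elim: (m i) => [|k ih]; rewrite ?expr0 -?mpolyC1 ?exprS; auto.
Qed.

Lemma mderiv_mpolyXU i j : mderiv i ('X_j : {mpoly R[n]}) = (i == j)%:R.
Proof.
rewrite mderivX mnm1E eq_sym; case: eqVneq => [->|_]; last by rewrite scale0r.
by rewrite -{1}[U_(j)%MM]add0m addmK mpolyX0 scale1r.
Qed.

Lemma mderiv_homog p d i : p \is d.+1.-homog -> mderiv i p \is d.-homog.
Proof.
move=> /dhomogP hp; rewrite [p]mpolyE big_seq linear_sum /=; apply: rpred_sum => m /hp hm.
rewrite linearZ /= mderivX; apply/dhomogZ.
have [->|mi] := posnP (m i); first by rewrite scale0r rpred0.
apply: dhomogZ; rewrite dhomogX; apply/eqP.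
have le : (U_(i) <= m)%MM.
  by apply/mnm_lepP => j; rewrite mnm1E; case: eqP => [<-|].
have := hm; rewrite -{1}(submK le) /= mdegD mdeg1; lia.
Qed.

Lemma euler_homog p d : p \is d.-homog ->
  \sum_(i < n) 'X_i * mderiv i p = d%:R *: p.
Proof.
move=> /dhomogP hp; rewrite [p in RHS]mpolyE scaler_sumr [in LHS](mpolyE p).
under eq_bigr do rewrite linear_sum mulr_sumr.
rewrite exchange_big /= big_seq [RHS]big_seq; apply: eq_bigr => m /hp /= <-.
transitivity (\sum_(i < n) (p@_m * (m i)%:R) *: ('X_[m] : {mpoly R[n]})).
  apply: eq_bigr => i _; rewrite linearZ /= mderivX -!scalerAr scalerA.
  rewrite -mpolyXD; have [->|mi] := posnP (m i); first by rewrite mulr0 !scale0r.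
  rewrite addmC submK //; apply/mnm_lepP => j.
  by rewrite mnm1E; case: eqP => [<-|].
by rewrite -scaler_suml -mulr_sumr scalerA mulrC mdegE natr_sum.
Qed.

Lemma comp_mpoly_homog k (lq : n.-tuple {mpoly R[k]}) p d e :
  (forall i, tnth lq i \is e.-homog) -> p \is d.-homog ->
  p \mPo lq \is (e * d).-homog.
Proof.
move=> hq /dhomogP hp; rewrite comp_mpolyEX big_seq; apply: rpred_sum => m /hp hm.
rewrite comp_mpolyX; apply: dhomogZ; rewrite -hm /= mdegE big_distrr /=.
elim/big_rec2: _ => [|i a q _ ha]; first exact: dhomog1.
by apply: dhomogM ha; exact: dhomogMn.
Qed.

Lemma mderiv_comp k (lq : n.-tuple {mpoly R[k]}) p j :
  mderiv j (p \mPo lq) =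
  \sum_(i < n) (mderiv i p \mPo lq) * mderiv j (tnth lq i).
Proof.
elim/mpoly_ring_ind: p => [c|l|p q hp hq|p q hp hq].
- rewrite comp_mpolyC mderivC big1 // => i _.
  by rewrite mderivC comp_mpoly0 mul0r.
- rewrite comp_mpolyXU -tnth_nth (bigD1 l) //= mderiv_mpolyXU eqxx rmorph1 mul1r.
  rewrite big1 ?addr0 // => i /negPf hi.
  by rewrite mderiv_mpolyXU hi rmorph0 mul0r.
- rewrite rmorphD mderivD hp hq -big_split; apply: eq_bigr => i _.
  by rewrite mderivD rmorphD mulrDl.
- rewrite rmorphM mderivM hp hq mulr_suml mulr_sumr -big_split.
  apply: eq_bigr => i _ /=; rewrite mderivM rmorphD !rmorphM /=; ring.
Qed.

Definition on_line (x v : 'I_n -> R) p : {poly R} :=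
  mmap (@polyC R) (fun i => (x i)%:P + (v i)%:P * 'X) p.

Lemma horner_on_line x v p t :
  (on_line x v p).[t] = p.@[fun i => x i + v i * t].
Proof.
elim/mpoly_ring_ind: p => [c|i|p q hp hq|p q hp hq].
- by rewrite /on_line mmapC mevalC hornerC.
- by rewrite /on_line mmapX mmap1U mevalXU !hornerE.
- by rewrite /on_line mmapD hornerD mevalD -hp -hq.
- by rewrite /on_line rmorphM /= hornerM mevalM -hp -hq.
Qed.

Lemma deriv_on_line x v p :
  (on_line x v p)^`() = \sum_(i < n) (v i)%:P * on_line x v (mderiv i p).
Proof.
pose L := on_line x v.
have L0 : L 0 = 0 by rewrite /L /on_line rmorph0.
have L1 : L 1 = 1 by rewrite /L /on_line rmorph1.
have LC k : L k%:MP = k%:P by rewrite /L /on_line mmapC.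
have LX i : L 'X_i = (x i)%:P + (v i)%:P * 'X by rewrite /L /on_line mmapX mmap1U.
have LD a b : L (a + b) = L a + L b by rewrite /L /on_line rmorphD.
have LM a b : L (a * b) = L a * L b by rewrite /L /on_line rmorphM.
rewrite -!/(L _); elim/mpoly_ring_ind: p => [k|i|a b ha hb|a b ha hb].
- rewrite LC derivC big1 // => i _.
  by rewrite -/(L _) mderivC L0 mulr0.
- rewrite LX derivD derivC add0r derivM derivC derivX mul0r add0r mulr1.
  rewrite (bigD1 i) //= -/(L _) mderiv_mpolyXU eqxx L1 mulr1 big1 ?addr0 // => j /negPf hj.
  by rewrite -/(L _) mderiv_mpolyXU hj L0 mulr0.
- rewrite LD derivD ha hb -big_split; apply: eq_bigr => i _ /=.
  by rewrite -!/(L _) mderivD LD mulrDr.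
- rewrite LM derivM ha hb mulr_suml mulr_sumr -big_split; apply: eq_bigr => i _ /=.
  by rewrite -!/(L _) mderivM LD !LM; ring.
Qed.

End MPolyBasics.

Lemma poly_neq0_eval (K : numDomainType) (q : {poly K}) :
  q != 0 -> exists t, q.[t] != 0.
Proof.
move=> q0; apply: contrapT => /forallNP h.
have := max_poly_roots (rs := [seq i%:R | i <- iota 0 (size q)]) q0.
rewrite size_map size_iota ltnn => H; apply/notF/H.
  by apply/allP => x _; apply/negPn/negP => hx; apply: (h x); exact: hx.
by rewrite map_inj_uniq ?iota_uniq // => i j /eqP; rewrite eqr_nat => /eqP.
Qed.

Lemma widen_ord_lift_max n (j : 'I_n) : widen_ord (leqnSn n) j = lift ord_max j.
Proof. by apply: val_inj; rewrite /= /bump leqNgt ltn_ord. Qed.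

Section MUniIso.
Context {n : nat} {R : idomainType}.

Definition of_muni (q : {poly {mpoly R[n]}}) : {mpoly R[n.+1]} :=
  (map_poly (@mwiden n R) q).['X_ord_max].

Lemma of_muniM : {morph of_muni : p q / p * q}.
Proof. by move=> p q; rewrite /of_muni rmorphM hornerM. Qed.

Lemma of_muni1 : of_muni 1 = 1.
Proof. by rewrite /of_muni rmorph1 hornerC. Qed.

Lemma muni_mpolyX (m : 'X_{1..n.+1}) : muni ('X_[m] : {mpoly R[n.+1]}) =
  'X_[[multinom (m (widen_ord (leqnSn n) i)) | i < n]] *: 'X^(m ord_max).
Proof. by rewrite muniE msuppX big_seq1 mcoeffX eqxx scale1r. Qed.

Lemma muniK : cancel (@muni n R) of_muni.
Proof.
have D p q : of_muni (p + q) = of_muni p + of_muni q.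
  by rewrite /of_muni rmorphD hornerD.
elim/mpolyind => [|c m p _ _ ih]; first by rewrite /of_muni !rmorph0 horner0.
rewrite muniD D [X in _ + X]ih; congr (_ + _); rewrite muniZ muni_mpolyX.
rewrite /of_muni !map_polyZ /= map_polyXn !hornerZ hornerXn mwidenC mul_mpolyC.
congr (_ *: _); rewrite mwidenX mpolyXn -mpolyXD; congr 'X_[_]; apply/mnmP => i.
rewrite mnmDE mulmnE mnm1E.
have [j ->|->] := unliftP ord_max i.
  rewrite -widen_ord_lift_max mnmwiden_widen mnmE.
  case: eqP => [/(congr1 val)/= e|]; last by rewrite mul0n addn0.
  by have := ltn_ord j; rewrite -e ltnn.
by rewrite mnmwiden_ordmax eqxx mul1n.
Qed.

Lemma of_muniK : cancel of_muni (@muni n R).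
Proof.
have W p : muni (mwiden p) = p%:P :> {poly {mpoly R[n]}}.
  elim/mpolyind: p => [|c m p _ _ ih]; first by rewrite mwiden0 muni0.
  rewrite mwidenD muniD ih polyCD mwidenZ muniZ mwidenX muni_mpolyX.
  rewrite mnmwiden_ordmax expr0 -mul_mpolyC polyCM -mul_polyC; congr (_ * _ + _).
  rewrite -mul_polyC mulr1; congr ('X_[_])%:P.
  by apply/mnmP => i; rewrite mnmE mnmwiden_widen.
have X : muni 'X_ord_max = 'X :> {poly {mpoly R[n]}}.
  rewrite muni_mpolyX mnm1E eqxx expr1.
  rewrite (_ : [multinom _ | i < n] = 0%MM) ?mpolyX0 ?scale1r //.
  apply/mnmP => i; rewrite mnmE mnm1E mnm0E; case: eqP => // /(congr1 val) /= e.
  by have := ltn_ord i; rewrite -e ltnn.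
move=> q; rewrite /of_muni horner_poly; rewrite (raddf_sum (@muni n R)) /=.
rewrite -[RHS]coefK poly_def; apply: eq_bigr => i _.
by rewrite rmorphM rmorphXn /= X W mul_polyC.
Qed.

End MUniIso.

Lemma prime_factorization_iso (R S : idomainType) (f : R -> S) (g : S -> R) :
  cancel f g -> cancel g f -> {morph g : x y / x * y} -> g 1 = 1 ->
  forall a, prime_factorization (f a) -> prime_factorization a.
Proof.
move=> fK gK gM g1 a [s [u [hs [v hv] e]]].
have fM x y : f (x * y) = f x * f y.
  by apply: (can_inj gK); rewrite gM !fK.
have g0 : g 0 = 0.
  have h : g 0 * 0 = g 0 by rewrite -{1}(fK 0) -gM mul0r.
  by rewrite -h mulr0.
exists [seq g p | p <- s], (g u); split.
- move=> _ /mapP [p /hs [p0 p1 pM] ->]; split.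
  + by apply: contraNneq p0 => h; rewrite -[p]gK h -g0 gK.
  + by case=> c h; case: p1; exists (f c); rewrite -[p]gK -fM -h -g1 gK.
  + move=> x y [c h]; have [|[d e']|[d e']] := pM (f x) (f y).
    * by exists (f c); rewrite -fM h fM gK.
    * by left; exists (g d); rewrite -[x]fK e' gM.
    * by right; exists (g d); rewrite -[y]fK e' gM.
- by exists (g v); rewrite -gM -hv.
- rewrite -[a]fK e gM; congr (_ * _); rewrite big_map.
  by elim: s {hs e} => [|p s ih]; rewrite ?big_nil // !big_cons gM ih.
Qed.

Theorem mpoly_factorial (K : fieldType) n (p : {mpoly K[n]}) :
  p != 0 -> prime_factorization p.
Proof.
elim: n p => [|n ih] p p0.
  exists [::], p; rewrite big_nil mulr1; split => //.
  have pE : p = (p@_0)%:MP.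
    apply/mpolyP => m; rewrite mcoeffC.
    have -> : m = 0%MM by apply/mnmP; case.
    by rewrite eqxx mulr1.
  exists (p@_0)^-1%:MP; rewrite {2}pE -mpolyCM mulVf ?mpolyC1 //.
  by apply: contraNneq p0 => z; rewrite pE z mpolyC0.
apply: (prime_factorization_iso muniK of_muniK of_muniM of_muni1).
apply: poly_factorial => //.
by apply: contraNneq p0 => z; rewrite -[p]muniK z /of_muni rmorph0 horner0.
Qed.

(** By induction on the number of variables: evaluate the leading coefficient in
    the last variable first. *)
Lemma mpoly_neq0_eval (K : numFieldType) n (p : {mpoly K[n]}) :
  p != 0 -> exists x : 'I_n -> K, p.@[x] != 0.
Proof.
elim: n p => [|n ih] p p0.
  exists (fun=> 0); apply: contraNneq p0 => h; apply/eqP/mpolyP => m.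
  rewrite mcoeff0 -h mevalE.
  have e (m' : 'X_{1..0}) : m' = m by apply/mnmP; case.
  rewrite (eq_bigr (fun m' => p@_m')); last by move=> m' _; rewrite big_ord0 mulr1.
  have [pm|/negPf pm] := boolP (m \in msupp p).
    rewrite (big_rem m) //= big_seq big1 ?addr0 // => m'.
    by rewrite (e m') mem_rem_uniq // inE eqxx.
  rewrite big_seq big1 ?memN_msupp_eq0 ?pm // => m'; by rewrite (e m') pm.
have q0 : muni p != 0.
  by apply: contraNneq p0 => z; rewrite -[p]muniK z /of_muni rmorph0 horner0.
have [x hx] := ih (lead_coef (muni p)) (ltac:(by rewrite lead_coef_eq0)).
pose q := map_poly (meval x) (muni p).
have [t ht] : exists t, q.[t] != 0.
  apply: poly_neq0_eval; apply: contraNneq hx => z.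
  by rewrite lead_coefE -(coef_map (meval x)) /= -/q z coef0.
exists (fun i => if unlift ord_max i is Some j then x j else t).
suff -> : p.@[fun i => if unlift ord_max i is Some j then x j else t] = q.[t] by [].
rewrite -[p in LHS]muniK /q; move: (muni p) => r {q0 hx q ht p0 p}.
rewrite /of_muni horner_poly raddf_sum /= horner_poly; apply: eq_bigr => i _.
rewrite mevalM rmorphXn /= mevalXU unlift_none; congr (_ * _).
elim/(@mpoly_ring_ind n K): (r`_i) => [c|j|a b ha hb|a b ha hb].
- by rewrite mwidenC !mevalC.
- by rewrite mwidenX mnmwiden1 !mevalXU widen_ord_lift_max liftK.
- by rewrite mwidenD !mevalD ha hb.
- by rewrite mwidenM !mevalM ha hb.
Qed.

Lemma mpoly_eval_inj (K : numFieldType) n (p q : {mpoly K[n]}) :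
  (forall x, p.@[x] = q.@[x]) -> p = q.
Proof.
move=> h; apply/eqP; rewrite -subr_eq0; apply/negPn/negP => /mpoly_neq0_eval [x].
by rewrite mevalB h subrr eqxx.
Qed.

(** * Algebraic independence *)

(** Jacobian criterion: differentiating a relation of least degree gives
    relations of smaller degree between the same polynomials. *)
Lemma jacobian_independent (K : numFieldType) r (F : r.-tuple {mpoly K[r]}) d
    (P : {mpoly K[r]}) :
  \det (\matrix_(i, j) mderiv j (tnth F i)) != 0 ->
  P \is d.-homog -> P \mPo F = 0 -> P = 0.
Proof.
move=> J0; elim: d P => [|d ih] P hP PF.
  have PE : P = (P@_0)%:MP.
    apply/mpolyP => m; rewrite mcoeffC; case: eqVneq => [->|hm]; first by rewrite mulr1.
    rewrite mulr0; apply: (dhomog_nemf_coeff hP).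
    by rewrite /= mdeg_eq0.
  by move: PF; rewrite PE comp_mpolyC.
have dP i : mderiv i P = 0.
  apply: ih; first exact: mderiv_homog.
  pose J := \matrix_(i, j) mderiv j (tnth F i).
  pose v := \row_i (mderiv i P \mPo F).
  have : v *m J *m \adj J = 0.
    rewrite (_ : v *m J = 0) ?mul0mx //; apply/rowP => j; rewrite !mxE.
    transitivity (mderiv j (P \mPo F)); last by rewrite PF linear0.
    by rewrite mderiv_comp; apply: eq_bigr => k _; rewrite !mxE.
  rewrite -mulmxA mul_mx_adj mul_mx_scalar => /rowP/(_ i); rewrite !mxE => /eqP.
  by rewrite mulf_eq0 (negPf J0) => /eqP.
have := euler_homog hP; rewrite big1 => [/esym/eqP|i _]; last by rewrite dP mulr0.
by rewrite scaler_eq0 pnatr_eq0 => /eqP.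
Qed.

(** The left-hand side grows like [D ^ r] and the right-hand side like
    [D ^ (r + 1)]; the witness comes from [e * D + r <= (e + r) * (D + 1)]. *)
Lemma ltn_bin_growth e r : exists D, ('C(e * D + r, e * D) < 'C(D + r.+1, D))%N.
Proof.
exists (r.+1 * (e + r) ^ r)%N; set D := (_ * _ ^ _)%N.
have b1 : ((D.+1) ^ r.+1 <= 'C(D + r.+1, D) * r.+1`!)%N.
  rewrite -(bin_sub (leq_addr _ _)) addKn bin_ffact.
  elim: r.+1 => [|k ih] //; rewrite expnS addnS ffactSS leq_mul //.
  by rewrite ltnS leq_addr.
have b2 : ('C(e * D + r, e * D) * r`! <= (e * D + r) ^ r)%N.
  rewrite -(bin_sub (leq_addr _ _)) addKn bin_ffact.
  move: (e * D + r)%N => m; elim: r {b1 D} m => [|k ih] m //.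
  rewrite ffactnSr expnSr leq_mul //; exact: leq_subr.
have b3 : ((e * D + r) ^ r <= (e + r) ^ r * D.+1 ^ r)%N.
  have mono a b k : (a <= b -> a ^ k <= b ^ k)%N.
    by case: k => // k h; rewrite leq_exp2r.
  by rewrite -expnMn; apply: mono; nia.
rewrite -(ltn_pmul2r (fact_gt0 r.+1)); apply: leq_trans b1.
rewrite factS mulnCA (leq_ltn_trans (leq_mul (leqnn _) (leq_trans b2 b3))) //.
by rewrite mulnA -/D expnS ltn_mul2r expn_gt0 /= ltnS leqnn.
Qed.

(** There are more monomials of large degree [D] in [r + 2] variables than
    monomials of degree [e * D] in [r + 1] variables. *)
Lemma forms_dependent (K : fieldType) r e (G : (r.+2).-tuple {mpoly K[r.+1]}) :
  (forall i, tnth G i \is e.-homog) ->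
  exists d (P : {mpoly K[r.+2]}), [/\ P \is d.-homog, P != 0 & P \mPo G = 0].
Proof.
move=> hG; have [D hD] := ltn_bin_growth e r.
have hc (P : dhomog r.+2 K D) : (P : {mpoly K[_]}) \mPo G \is (e * D).-homog.
  exact: comp_mpoly_homog hG (dhomog_is_dhomog P).
pose f (P : dhomog r.+2 K D) : dhomog r.+1 K (e * D) := DHomog (hc P).
have lf : linear f.
  by move=> a p q; apply: val_inj; rewrite /= comp_mpolyD comp_mpolyZ.
pose fl := GRing.isLinear.Build _ _ _ _ f lf.
pose F : {linear dhomog r.+2 K D -> dhomog r.+1 K (e * D)} := HB.pack f fl.
have : (0 < \dim (lker (linfun F)))%N.
  have := limg_ker_dim (linfun F) fullv; rewrite capfv dimvf => e1.
  have := dimvS (subvf (limg (linfun F))); rewrite dimvf => e2.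
  have E1 : dim (dhomog r.+2 K D) = 'C(D + r.+1, D) by [].
  have E2 : dim (dhomog r.+1 K (e * D)) = 'C(e * D + r, e * D) by [].
  rewrite E1 in e1; rewrite E2 in e2; lia.
rewrite lt0n dimv_eq0 => k0; have := memv_pick (lker (linfun F)).
have := k0; rewrite -vpick0; move: (vpick _) => P P0.
rewrite memv_ker lfunE /= => /eqP/(congr1 val) /= h.
exists D, (P : {mpoly K[_]}); split; [exact: dhomog_is_dhomog | exact: P0 | exact: h].
Qed.

(** * Matrix Lie algebras with abelian subalgebras of dimension at most one *)

Section StableEigenvector.
Context {K : numClosedFieldType} {V : vectType K}.

Lemma stable_eigenvector (f : 'End(V)) (U : {vspace V}) :
  U != 0%VS -> (f @: U <= U)%VS ->
  exists v a, [/\ v \in U, v != 0 & f v = a *: v].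
Proof.
move=> U0 fU.
pose b := vbasis U.
have bU i : b`_i \in U.
  have [hi|hi] := ltnP i (size b); first exact/vbasis_mem/mem_nth.
  by rewrite nth_default ?mem0v.
pose M := \matrix_(i, j < \dim U) coord b j (f b`_i).
have [|a /eigenvalueP [u uM u0]] := @eigenvalue_closed K _ M.
  by rewrite lt0n dimv_eq0.
exists (\sum_i u 0 i *: b`_i), a; split.
- by apply: memv_suml => i _; apply: memvZ.
- apply: contraNneq u0 => h; apply/eqP/rowP => i; rewrite mxE.
  have /freeP fr := basis_free (vbasisP U).
  exact: (fr (fun i => u 0 i) h i).
rewrite linear_sum scaler_sumr /=.
transitivity (\sum_i \sum_j (u 0 i * M i j) *: b`_j).
  apply: eq_bigr => i _; rewrite linearZ /= {1}(@coord_vbasis _ _ (f b`_i) U); last first.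
    by apply: (subvP fU); apply: memv_img.
  by rewrite scaler_sumr; apply: eq_bigr => j _; rewrite mxE scalerA.
rewrite exchange_big; apply: eq_bigr => j _ /=.
by move/rowP/(_ j): uM; rewrite !mxE scalerA => <-; rewrite scaler_suml.
Qed.

End StableEigenvector.

Section MatrixLie.
Context {K : numClosedFieldType} {n : nat}.
Notation M := 'M[K]_n.+1.
Implicit Types (X Y Z T S A B : M).

Definition commutator A B := A * B - B * A.

Lemma commutator_linear A : linear (commutator A).
Proof.
move=> c B C; rewrite /commutator mulrDr mulrDl -scalerAl -scalerAr scalerBr.
by rewrite opprD addrACA.
Qed.

HB.instance Definition _ A := GRing.isLinear.Build K M M *:%R (commutator A)
  (commutator_linear A).

Lemma commutatorC A B : commutator A B = - commutator B A.
Proof. by rewrite /commutator opprB. Qed.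

Lemma commutatorAA A : commutator A A = 0.
Proof. by rewrite /commutator subrr. Qed.

Lemma jacobi A B C : commutator A (commutator B C) =
  commutator (commutator A B) C + commutator B (commutator A C).
Proof.
rewrite /commutator !mulrBr !mulrBl !mulrA.
move: (A * B * C) (A * C * B) (B * C * A) (C * B * A) (B * A * C) (C * A * B).
by move=> a b c d e f; apply/matrixP => i j; rewrite !mxE; ring.
Qed.

(** [q |-> horner_mx Y q] intertwines the derivation [A |-> [A, T]] with
    [q |-> X q'], so the minimal polynomial of [Y] is an eigenvector of the
    latter, that is a power of [X]. *)
Lemma commutator_eigen_nilpotent Y T : commutator Y T = Y -> Y ^+ n.+1 = 0.
Proof.
move=> YT.
have hX k : Y ^+ k * T - T * Y ^+ k = k%:R *: Y ^+ k.
  elim: k => [|k ih]; first by rewrite mul1r mulr1 subrr scale0r.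
  have -> : Y ^+ k.+1 * T - T * Y ^+ k.+1 =
      Y * (Y ^+ k * T - T * Y ^+ k) + commutator Y T * Y ^+ k.
    by rewrite /commutator mulrBr mulrBl exprS !mulrA addrA subrK.
  by rewrite ih YT -scalerAr -!exprS -natr1 scalerDl scale1r.
have hp (q : {poly K}) :
    horner_mx Y q * T - T * horner_mx Y q = horner_mx Y ('X * q^`()).
  rewrite -[q]coefK poly_def; move: (size q) => s.
  rewrite [(\sum_(_ < _) _)^`()]raddf_sum mulr_sumr !rmorph_sum /= mulr_suml mulr_sumr -sumrB.
  apply: eq_bigr => i _; rewrite derivZ derivXn -scalerAr !horner_mxZ -scalerAl -scalerAr.
  rewrite -scalerBr rmorphXn /= horner_mx_X hX; congr (_ *: _).
  rewrite mulrnAr rmorphMn rmorphM rmorphXn /= horner_mx_X scaler_nat.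
  by case: (val i) => [|k]; rewrite ?mulr0n //= exprS.
pose p := mxminpoly Y; pose d := degree_mxminpoly Y.
have sp : size p = d.+1 by exact: size_mxminpoly.
have lp : p`_d = 1 by have /monicP := mxminpoly_monic Y; rewrite lead_coefE sp.
pose q := d%:R *: p - 'X * p^`().
have qE i : q`_i = (d%:R - i%:R) * p`_i.
  rewrite coefB coefZ coefXM coef_deriv; case: i => [|i] /=; first by rewrite !subr0.
  by rewrite mulrBl [i.+1%:R * _]mulr_natl.
have q0 : q = 0.
  apply/eqP/negPn/negP => q0.
  have : p %| q.
    apply: mxminpoly_min; rewrite /q rmorphB /= horner_mxZ -hp.
    by rewrite mx_root_minpoly scaler0 mul0r mulr0 !subr0.
  move=> /(dvdp_leq q0); rewrite sp ltnNge => /negP; apply.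
  apply/leq_sizeP => j; rewrite leq_eqVlt => /orP [/eqP <-|hj].
    by rewrite qE subrr mul0r.
  by rewrite qE nth_default ?mulr0 // sp.
have pE : p = 'X^d.
  apply/polyP => i; rewrite coefXn; case: eqVneq => [-> //|hi].
  have /eqP := qE i; rewrite q0 coef0 eq_sym mulf_eq0 subr_eq0 eqr_nat eq_sym.
  by rewrite (negPf hi) => /eqP.
have Yd : Y ^+ d = 0.
  by rewrite -[Y]horner_mx_X -rmorphXn -pE; exact: mx_root_minpoly.
have le : (d <= n.+1)%N.
  have := dvdp_leq _ (mxminpoly_dvd_char Y); rewrite -/p sp size_char_poly ltnS; apply.
  by rewrite -size_poly_gt0 size_char_poly.
by have := exprD Y (n.+1 - d) d; rewrite Yd mulr0 subnK.
Qed.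

(** A word in one [Z] and many [Y] contains [Y ^ k] on the left or on the
    right of [Z]. *)
Lemma iter_commutator_nilpotent Y Z k :
  Y ^+ k = 0 -> iter (k + k) (commutator Y) Z = 0.
Proof.
move=> Yk.
have Yge j : (k <= j)%N -> Y ^+ j = 0 by move=> h; rewrite -(subnK h) exprD Yk mulr0.
suff H c : forall a b, (k + k <= a + b + c)%N ->
    Y ^+ a * iter c (commutator Y) Z * Y ^+ b = 0.
  by have := H (k + k)%N 0%N 0%N (leqnn _); rewrite mul1r mulr1.
elim: c => [|c ih] a b hab.
  have [h|h] := leqP k a; first by rewrite Yge // !mul0r.
  by rewrite (Yge b) ?mulr0 //; lia.
rewrite /= {1}/commutator mulrBr mulrBl !mulrA -exprSr ih; last by lia.
by rewrite -[_ * Y * _]mulrA -exprS ih ?subrr //; lia.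
Qed.

Section Sl2.
Context (g : {vspace M}).
Hypothesis gL : forall A B, A \in g -> B \in g -> commutator A B \in g.
Hypothesis gC : forall A B, A \in g -> B \in g -> A != 0 ->
  commutator A B = 0 -> B \in <[A]>%VS.

(** An eigenvector of [ad X] on its own image is either a proper one, or
    proportional to [X], and then [X] itself lies in the image. *)
Lemma exists_affine_pair : (1 < \dim g)%N ->
  exists Y T, [/\ Y \in g, T \in g, Y != 0 & commutator Y T = Y].
Proof.
move=> dg; pose X := vpick g.
have Xg : X \in g := memv_pick g.
have X0 : X != 0 by rewrite vpick0 -dimv_eq0; case: (\dim g) dg.
pose f : 'End(M) := linfun (commutator X).
pose U := (f @: g)%VS.
have Ug : (U <= g)%VS.
  by apply/subvP => _ /memv_imgP [A Ag ->]; rewrite lfunE; exact: gL.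
have U0 : U != 0%VS.
  have := limg_ker_dim f g; rewrite -/U -dimv_eq0.
  have : (\dim (g :&: lker f) <= 1)%N.
    apply: (leq_trans (dimvS (_ : _ <= <[X]>)%VS)); last by rewrite dim_vline leq_b1.
    apply/subvP => A; rewrite memv_cap memv_ker lfunE => /andP [Ag /eqP h].
    exact: gC.
  by move=> h1 h2; rewrite -lt0n -(ltn_add2l 1) (leq_trans dg) // -h2 leq_add2r.
have [Y [a [YU Y0 fY]]] := stable_eigenvector U0 (limgS f Ug).
have Yg : Y \in g := subvP Ug _ YU.
move: fY; rewrite lfunE /= => fY.
have [a0|a0] := eqVneq a 0.
  have /vlineP [c YE] : Y \in <[X]>%VS by apply: gC => //; rewrite fY a0 scale0r.
  have c0 : c != 0 by apply: contraNneq Y0 => c0; rewrite YE c0 scale0r.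
  have /memv_imgP [A Ag AE] := YU.
  exists X, (c^-1 *: A); split => //; first exact: memvZ.
  move: AE; rewrite linearZ lfunE /= => <-.
  by rewrite YE scalerA mulVf ?scale1r.
exists Y, (- a^-1 *: X); split => //; first exact: memvZ.
by rewrite linearZ /= commutatorC fY scaleNr scalerN opprK scalerA mulVf ?scale1r.
Qed.

(** Since [ad Y] is nilpotent with kernel of dimension one, it has a single
    Jordan block on [g], which provides [S] above [T] up to multiples of [T] and
    [Y]; Jacobi's identity then gives [[T, S] = S] modulo [Y]. *)
Lemma exists_sl2_triple : (2 < \dim g)%N ->
  exists Y T S, [/\ [/\ Y \in g, T \in g & S \in g], Y != 0, commutator Y T = Y,
    commutator Y S = T & commutator T S = S].
Proof.
move=> dg; have [Y [T [Yg Tg Y0 YT]]] := exists_affine_pair (ltnW dg).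
pose U := (<[Y]> + <[T]>)%VS.
have UP A : A \in U <-> exists a b, A = a *: Y + b *: T.
  split=> [/memv_addP [_ /vlineP [a ->] [_ /vlineP [b ->] ->]]|[a [b ->]]].
    by exists a, b.
  by apply: memv_add; apply/vlineP; [exists a|exists b].
have [Z Zg ZU] : exists2 Z, Z \in g & Z \notin U.
  apply/subvPn; apply/negP => /dimvS; rewrite leqNgt => /negP; apply.
  apply: leq_trans dg; rewrite ltnS.
  by rewrite (leq_trans (dimv_add_leqif _ _)) // !dim_vline (leq_add (leq_b1 _) (leq_b1 _)).
have ex : exists k, iter k (commutator Y) Z \in U.
  exists (n.+1 + n.+1)%N; rewrite iter_commutator_nilpotent ?mem0v //.
  exact: commutator_eigen_nilpotent YT.
case: (ex_minnP ex) => -[|k] hk kmin; first by rewrite hk in ZU.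
pose W := iter k (commutator Y) Z.
have Wg : W \in g by rewrite /W; elim: (k) => [|j ih] //=; exact: gL.
have WU : W \notin U by apply/negP => /kmin; rewrite ltnn.
have [a [b YW]] := (UP _).1 hk; rewrite /= -/W in YW.
have b0 : b != 0.
  apply: contraNneq WU => b0.
  have /vlineP [c WE] : W - a *: T \in <[Y]>%VS.
    apply: gC => //; first by rewrite memvB ?memvZ.
    by rewrite linearB linearZ /= YW YT b0 scale0r addr0 subrr.
  by apply/UP; exists c, a; rewrite -WE subrK.
pose S0 := b^-1 *: (W - a *: T).
have S0g : S0 \in g by rewrite memvZ // memvB ?memvZ.
have YS0 : commutator Y S0 = T.
  by rewrite linearZ linearB linearZ /= YW YT addrC addKr scalerA mulVf ?scale1r.
clearbody S0.
have /vlineP [c TS0] : commutator T S0 - S0 \in <[Y]>%VS.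
  apply: gC => //; first by rewrite memvB ?gL.
  by rewrite linearB /= jacobi YT YS0 commutatorAA addr0 subrr.
(* The multiple of [Y] that corrects [[T, S0] = S0 + c Y]. *)
exists Y, T, (S0 + (c / 2) *: Y); split => //.
  by split => //; exact: memvD S0g (memvZ _ Yg).
  by rewrite linearD linearZ /= YS0 commutatorAA scaler0 addr0.
rewrite linearD linearZ /= [commutator T Y]commutatorC YT scalerN.
rewrite -[commutator T S0](subrK S0) TS0 addrAC [RHS]addrC -scalerBl.
by congr (_ *: _ + _); field.
Qed.
End Sl2.
End MatrixLie.

(** * Infinitesimal symmetries of a 1-form *)

Lemma sum3 (V : nmodType) (F : 'I_3 -> V) : \sum_(i < 3) F i = F 0 + F 1 + F 2%:R.
Proof.
rewrite !big_ord_recl big_ord0 addr0 addrA; congr (_ + _ + _).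
  by congr F; apply: val_inj.
by congr F; apply: val_inj.
Qed.

Lemma ord3P (P : 'I_3 -> Prop) : P 0 -> P 1 -> P 2%:R -> forall i, P i.
Proof.
move=> p0 p1 p2 [[|[|[|//]]] h].
- by rewrite (_ : Ordinal h = 0) //; apply: val_inj.
- by rewrite (_ : Ordinal h = 1) //; apply: val_inj.
- by rewrite (_ : Ordinal h = 2%:R) //; apply: val_inj.
Qed.

Section LinearField.
Context {K : numClosedFieldType}.
Notation poly3 := {mpoly K[3]}.
Implicit Types (A B : 'M[K]_3) (p q : poly3).

Definition linear_field (i : 'I_3) B : poly3 := \sum_(k < 3) B i k *: 'X_k.

Lemma linear_field_is_linear i : linear (linear_field i).
Proof.
move=> c A B; rewrite /linear_field scaler_sumr -big_split; apply: eq_bigr => k _.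
by rewrite !mxE /= scalerDl scalerA.
Qed.
HB.instance Definition _ i := GRing.isLinear.Build K 'M[K]_3 poly3 *:%R
  (linear_field i) (linear_field_is_linear i).

Lemma linear_fieldB A B i :
  linear_field i (A - B) = linear_field i A - linear_field i B.
Proof. exact: linearB. Qed.

Lemma linear_field_homog B i : linear_field i B \is 1.-homog.
Proof. by apply: rpred_sum => k _; apply: dhomogZ; rewrite dhomogX /= mdeg1. Qed.

Lemma mderiv_linear_field i B j : mderiv j (linear_field i B) = (B i j)%:MP.
Proof.
rewrite linear_sum (bigD1 j) //= linearZ /= mderiv_mpolyXU eqxx -mul_mpolyC mulr1.
rewrite big1 ?addr0 // => k /negPf hk.
by rewrite linearZ /= mderiv_mpolyXU eq_sym hk scaler0.
Qed.

Lemma linear_fieldM A B i :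
  linear_field i (A * B) = \sum_(k < 3) A i k *: linear_field k B.
Proof.
under eq_bigr do rewrite scaler_sumr; rewrite exchange_big; apply: eq_bigr => k _.
rewrite mxE /= scaler_suml; apply: eq_bigr => l _; by rewrite scalerA.
Qed.

Lemma meval_linear_field i B v :
  (linear_field i B).@[v] = \sum_(k < 3) B i k * v k.
Proof. by rewrite raddf_sum; apply: eq_bigr => k _; rewrite /= mevalZ mevalXU. Qed.

Definition derive_along B p : poly3 := \sum_(k < 3) linear_field k B * mderiv k p.

Lemma derive_along_is_linear B : linear (derive_along B).
Proof.
move=> c p q; rewrite /derive_along scaler_sumr -big_split; apply: eq_bigr => k _ /=.
by rewrite linearP /= mulrDr -scalerAr.
Qed.
HB.instance Definition _ B := GRing.isLinear.Build K poly3 poly3 *:%R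
  (derive_along B) (derive_along_is_linear B).

Lemma derive_alongN B p : derive_along B (- p) = - derive_along B p.
Proof. exact: linearN. Qed.

Lemma derive_alongZ B c p : derive_along B (c *: p) = c *: derive_along B p.
Proof. exact: linearZ. Qed.

Lemma derive_along_sum B (I : Type) (r : seq I) (F : I -> poly3) :
  derive_along B (\sum_(i <- r) F i) = \sum_(i <- r) derive_along B (F i).
Proof. exact: linear_sum. Qed.

Lemma derive_alongM B p q :
  derive_along B (p * q) = derive_along B p * q + p * derive_along B q.
Proof.
rewrite /derive_along mulr_suml mulr_sumr -big_split; apply: eq_bigr => k _ /=.
by rewrite mderivM; ring.
Qed.

Lemma derive_along_linear_field A B i :
  derive_along A (linear_field i B) = linear_field i (B * A).
Proof.
rewrite linear_fieldM; apply: eq_bigr => k _.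
by rewrite mderiv_linear_field mulrC mul_mpolyC.
Qed.

(** Linear vector fields bracket in the order opposite to matrices. *)
Lemma derive_along_commutator A B p :
  derive_along (commutator A B) p =
  derive_along B (derive_along A p) - derive_along A (derive_along B p).
Proof.
have H C D : derive_along D (derive_along C p) = derive_along (C * D) p +
    \sum_k \sum_l linear_field k C * linear_field l D * mderiv l (mderiv k p).
  rewrite [derive_along C p]/derive_along linear_sum /=.
  rewrite [derive_along (C * D) p]/derive_along -big_split.
  apply: eq_bigr => k _ /=; rewrite derive_alongM derive_along_linear_field.
  congr (_ + _); rewrite /derive_along mulr_sumr.
  by apply: eq_bigr => l _; rewrite mulrA.
rewrite !H exchange_big /= opprD addrACA [X in _ + X](_ : _ = 0) ?addr0.
  rewrite /derive_along -sumrB; apply: eq_bigr => k _.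
  by rewrite linear_fieldB mulrBl.
rewrite -sumrB big1 // => k _; rewrite -sumrB big1 // => l _.
by rewrite mderiv_comm; ring.
Qed.

End LinearField.

Section Isotropy.
Context {K : numClosedFieldType}.
Notation poly3 := {mpoly K[3]}.
Implicit Types (A B : 'M[K]_3) (w : 'I_3 -> poly3).

Definition contraction w B : poly3 := \sum_(i < 3) w i * linear_field i B.

(** Lie derivative of the form with coefficients [w] along [x |-> B x]. *)
Definition lie_derivative w B (j : 'I_3) : poly3 :=
  derive_along B (w j) + \sum_(i < 3) B i j *: w i.

Definition isotropic w B := forall j, lie_derivative w B j = 0.

Lemma contraction_is_linear w : linear (contraction w).
Proof.
move=> c A B; rewrite /contraction scaler_sumr -big_split; apply: eq_bigr => i _ /=.
by rewrite linearP /= mulrDr -scalerAr.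
Qed.
HB.instance Definition _ w := GRing.isLinear.Build K 'M[K]_3 poly3 *:%R
  (contraction w) (contraction_is_linear w).

Lemma meval_contraction w B v : (contraction w B).@[v] =
  \sum_(i < 3) (w i).@[v] * \sum_(k < 3) B i k * v k.
Proof.
by rewrite raddf_sum; apply: eq_bigr => i _; rewrite /= mevalM meval_linear_field.
Qed.

Lemma isotropicE w B j : isotropic w B ->
  derive_along B (w j) = - \sum_(i < 3) B i j *: w i.
Proof. by move=> /(_ j) /eqP; rewrite addr_eq0 => /eqP. Qed.

Lemma isotropic_commutator w A B :
  isotropic w A -> isotropic w B -> isotropic w (commutator A B).
Proof.
have H C D j : isotropic w C -> isotropic w D ->
    derive_along D (derive_along C (w j)) = \sum_(i < 3) (D * C) i j *: w i.
  move=> hC hD; rewrite isotropicE // derive_alongN derive_along_sum -sumrN.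
  under eq_bigr do rewrite derive_alongZ isotropicE // scalerN opprK scaler_sumr.
  rewrite exchange_big; apply: eq_bigr => i _; rewrite mxE scaler_suml.
  by apply: eq_bigr => k _; rewrite scalerA mulrC.
move=> hA hB j; rewrite /lie_derivative derive_along_commutator !H //.
rewrite -sumrB -big_split big1 // => i _ /=.
have -> : commutator A B i j = (A * B) i j - (B * A) i j by rewrite !mxE.
by rewrite -scalerBl -scalerDl addrC subrKA subrr scale0r.
Qed.

(** Leibniz: the Lie derivative of [w] along [A] vanishes, and only the
    bracket of the two fields remains. *)
Lemma derive_along_contraction w A B : isotropic w A ->
  derive_along A (contraction w B) = - contraction w (commutator A B).
Proof.
move=> hA; rewrite /contraction derive_along_sum.
under eq_bigr do
  rewrite derive_alongM derive_along_linear_field isotropicE // mulNr mulr_suml.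
rewrite big_split sumrN /= exchange_big /= -[in RHS]sumrN -sumrN -big_split /=.
apply: eq_bigr => i _; rewrite linear_fieldB [linear_field i (A * B)]linear_fieldM.
rewrite mulrBr opprB addrC; congr (_ - _); rewrite [RHS]mulr_sumr.
by apply: eq_bigr => k _; rewrite -scalerAl -scalerAr.
Qed.

(** Coefficients of the exterior derivative of the form [w]. *)
Definition curl w (k j : 'I_3) : poly3 := mderiv k (w j) - mderiv j (w k).

(** Cartan's formula. *)
Lemma mderiv_contraction w B j : isotropic w B ->
  mderiv j (contraction w B) = - \sum_(k < 3) linear_field k B * curl w k j.
Proof.
move=> hB; rewrite /contraction [mderiv j (\sum_i _)]linear_sum /=.
under eq_bigr do rewrite mderivM mderiv_linear_field mulrC [_ * _%:MP]mulrC mul_mpolyC.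
have := isotropicE j hB; rewrite big_split /= => /eqP.
rewrite eq_sym eqr_oppLR => /eqP ->.
rewrite /derive_along -sumrB -sumrN; apply: eq_bigr => k _.
by rewrite /curl; ring.
Qed.

Section Radial.
Context {w : 'I_3 -> poly3} {d : nat}.
Hypothesis wH : forall i, w i \is d.-homog.
Hypothesis wR : \sum_(i < 3) w i * 'X_i = 0.

(** Euler's identity makes [w] a multiple of the contraction of its differential
    with the radial field. *)
Lemma radial_integrable :
  w 0 * curl w 1 2%:R + w 1 * curl w 2%:R 0 + w 2%:R * curl w 0 1 = 0.
Proof.
have E j : d.+1%:R * w j = \sum_(k < 3) 'X_k * curl w k j.
  have := congr1 (mderiv j) wR; rewrite [mderiv j (\sum_i _)]linear_sum linear0 /=.
  under eq_bigr do rewrite mderivM mderiv_mpolyXU.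
  rewrite big_split /= [X in _ + X](_ : _ = w j); last first.
    rewrite (bigD1 j) //= eqxx mulr1 big1 ?addr0 // => i /negPf hi.
    by rewrite eq_sym hi mulr0.
  move=> /eqP; rewrite addr_eq0 => /eqP h.
  rewrite -natr1 mulrDl mul1r -[X in _ + X]opprK -h.
  have := euler_homog (wH j); rewrite scaler_nat mulr_natl => <-.
  by rewrite -sumrB; apply: eq_bigr => k _; rewrite /curl; ring.
have d0 : d.+1%:R != 0 :> poly3.
  by rewrite -mpolyC_nat mpolyC_eq0 pnatr_eq0.
apply: (mulfI d0); rewrite mulr0 !mulrDr !mulrA !E !sum3 /curl; ring.
Qed.

(** Contract the vanishing 3-form [w /\ dw] with the two fields and apply
    Cartan's formula; each case below is a multiple of the coefficient of that
    3-form by a minor of the two fields. *)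
Lemma wronskian_contraction A B j : isotropic w A -> isotropic w B ->
  contraction w A * mderiv j (contraction w B) -
  contraction w B * mderiv j (contraction w A) = - contraction w (commutator A B) * w j.
Proof.
move=> hA hB; rewrite -derive_along_contraction // /derive_along.
under [in RHS]eq_bigr do rewrite mderiv_contraction //.
rewrite !mderiv_contraction // /contraction.
have C k l : curl w k l = - curl w l k by rewrite /curl opprB.
have C0 k : curl w k k = 0 by rewrite /curl subrr.
have I := radial_integrable; rewrite (C 2%:R 0) in I.
apply/eqP; rewrite -subr_eq0; apply/eqP; rewrite !sum3 !C0.
rewrite (C 1 0) (C 2%:R 0) (C 2%:R 1).
move: j; apply: ord3P; rewrite ?C0 ?(C 1 0) ?(C 2%:R 0) ?(C 2%:R 1).
- transitivity ((linear_field 2%:R A * linear_field 1 B -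
      linear_field 1 A * linear_field 2%:R B) *
    (w 0 * curl w 1 2%:R + w 1 * - curl w 0 2%:R + w 2%:R * curl w 0 1)).
    2: by rewrite I mulr0.
  move: (curl w 0 1) (curl w 0 2%:R) (curl w 1 2%:R) => c d1 e; ring.
- transitivity ((linear_field 0 A * linear_field 2%:R B -
      linear_field 2%:R A * linear_field 0 B) *
    (w 0 * curl w 1 2%:R + w 1 * - curl w 0 2%:R + w 2%:R * curl w 0 1)).
    2: by rewrite I mulr0.
  move: (curl w 0 1) (curl w 0 2%:R) (curl w 1 2%:R) => c d1 e; ring.
- transitivity ((linear_field 1 A * linear_field 0 B -
      linear_field 0 A * linear_field 1 B) *
    (w 0 * curl w 1 2%:R + w 1 * - curl w 0 2%:R + w 2%:R * curl w 0 1)).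
    2: by rewrite I mulr0.
  move: (curl w 0 1) (curl w 0 2%:R) (curl w 1 2%:R) => c d1 e; ring.
Qed.
End Radial.
End Isotropy.

Lemma msize_homog n (K : fieldType) (p : {mpoly K[n]}) d :
  p != 0 -> p \is d.-homog -> msize p = d.+1.
Proof.
move=> p0 hp; rewrite (dhomog_uniq p0 hp (dhomog_msize hp)) prednK //.
by rewrite lt0n msize_poly_eq0.
Qed.

(** Choose [c] such that [q - c p] vanishes at a point where [p] does not. Along
    a line through that point the relation would force a nonzero [q - c p] to
    vanish to an order at most that of its derivative. *)
Lemma wronskian_eq0_colinear n (K : numFieldType) (p q : {mpoly K[n]}) :
  p != 0 -> (forall i, p * mderiv i q = q * mderiv i p) -> exists c, q = c *: p.
Proof.
move=> /mpoly_neq0_eval [x px] H; pose c := q.@[x] / p.@[x]; exists c.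
apply/eqP; rewrite -subr_eq0; set r := q - _; apply/negPn/negP.
move=> /mpoly_neq0_eval [y ry].
have rx : r.@[x] = 0 by rewrite mevalB mevalZ divfK ?subrr.
have Hr i : p * mderiv i r = r * mderiv i p.
  by rewrite mderivB mderivZ mulrBr mulrBl H -scalerAr -scalerAl.
pose L := on_line x (fun i => y i - x i).
have LM a b : L (a * b) = L a * L b by rewrite /L /on_line rmorphM.
have dL a : (L a)^`() = \sum_i (y i - x i)%:P * L (mderiv i a) by exact: deriv_on_line.
have E : L p * (L r)^`() = L r * (L p)^`().
  rewrite !dL !mulr_sumr; apply: eq_bigr => i _.
  by rewrite mulrCA -LM Hr LM; ring.
have Lx a : (L a).[0] = a.@[x].
  by rewrite horner_on_line; apply: meval_eq => i; rewrite mulr0 addr0.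
have r0 : L r != 0.
  apply: contraNneq ry => z; have := horner_on_line x (fun i => y i - x i) r 1.
  rewrite -/(L r) z horner0 => /esym h; apply/eqP; rewrite -[RHS]h.
  by apply: meval_eq => i; rewrite mulr1 addrC subrK.
have [k [s s0 Ls]] := multiplicity_XsubC (L r) 0.
rewrite r0 /= subr0 in s0 Ls.
case: k Ls => [|k] Ls.
  by move: s0; rewrite rootE -[s]mulr1 -(expr0 'X) -Ls Lx rx eqxx.
move: E; rewrite Ls derivM derivXn mulrnAr exprS /= => E.
have {}E : L p * (s^`() * 'X + s *+ k.+1) = s * 'X * (L p)^`().
  have X0 : 'X^k != 0 :> {poly K} by rewrite expf_neq0 ?polyX_eq0.
  apply: (mulfI X0); move: ('X^k) E {X0 Ls} => Z.
  rewrite -[s * Z *+ _]mulr_natr -[s *+ _]mulr_natr; move: (k.+1%:R) => c' E.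
  transitivity (L p * (s^`() * ('X * Z) + s * Z * c')); first by ring.
  by rewrite E; ring.
move/(congr1 (horner^~ 0)): E.
rewrite !hornerM hornerD hornerM hornerMn hornerX !mulr0 add0r mul0r Lx => /eqP.
by rewrite mulf_eq0 (negPf px) /= mulrn_eq0 /=; apply/negP.
Qed.

Section PrimitiveForm.
Context {K : numClosedFieldType} {w : 'I_3 -> {mpoly K[3]}} {d : nat}.
Hypothesis wH : forall i, w i \is d.-homog.
Hypothesis wR : \sum_(i < 3) w i * 'X_i = 0.
Hypothesis wP : forall p, (forall i, exists q, w i = q * p) -> (msize p <= 1)%N.
Hypothesis d3 : (2 < d)%N.
Implicit Types (A B : 'M[K]_3).

Lemma primitive_form_neq0 : exists i, w i != 0.
Proof.
apply: contrapT => /forallNP h.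
have /wP : forall i, exists q, w i = q * 'X_0.
  by move=> i; exists 0; rewrite mul0r; apply/eqP/negPn/negP/h.
by rewrite msizeX mdeg1.
Qed.

Lemma linear_field_colinear_scalar B :
  (forall i j, 'X_i * linear_field j B = 'X_j * linear_field i B) ->
  B = (B 0 0)%:M.
Proof.
move=> H.
have E i j v : v i * (\sum_k B j k * v k) = v j * (\sum_k B i k * v k).
  by have := congr1 (meval v) (H i j); rewrite !mevalM !mevalXU !meval_linear_field.
have S i (k : 'I_3) : \sum_l B i l * (l == k)%:R = B i k.
  rewrite (bigD1 k) //= eqxx mulr1 big1 ?addr0 // => l /negPf ->.
  by rewrite mulr0.
have off i j : i != j -> B i j = 0.
  move=> /negPf hij; have := E j i (fun k => (k == j)%:R).
  by rewrite !S eqxx hij mul1r mul0r.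
have diag i j : B i i = B j j.
  have [->//|hij] := eqVneq i j; have hji : j != i by rewrite eq_sym.
  have := E i j (fun k => (k == i)%:R + (k == j)%:R).
  rewrite !eqxx (negPf hij) (negPf hji) addr0 add0r !mul1r.
  under eq_bigr do rewrite mulrDr; under [RHS]eq_bigr do rewrite mulrDr.
  by rewrite !big_split /= !S (off _ _ hij) (off _ _ hji) addr0 add0r.
apply/matrixP => i j; rewrite mxE; case: eqVneq => [->|/off ->//].
by rewrite mulr1n; exact: diag.
Qed.

(** [w] annihilates the fields [x] and [B x], so it is colinear with their
    cross product, hence divides it by primitivity; but the cross product has
    degree two, less than that of [w]. *)
Lemma contraction_eq0_scalar B : contraction w B = 0 -> B = (B 0 0)%:M.
Proof.
move=> wB; apply: linear_field_colinear_scalar.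
pose b i := linear_field i B.
pose v (i : 'I_3) : {mpoly K[3]} :=
  if i == 0 then 'X_1 * b 2%:R - 'X_2%:R * b 1
  else if i == 1 then 'X_2%:R * b 0 - 'X_0 * b 2%:R
  else 'X_0 * b 1 - 'X_1 * b 0.
have vH i : v i \is 2.-homog.
  have h j k : 'X_j * b k \is 2.-homog.
    apply: (@dhomogM _ _ _ 1 _ 1); first by rewrite dhomogX /= mdeg1.
    exact: linear_field_homog.
  by rewrite /v; case: ifP => _; [|case: ifP => _]; apply: rpredB.
have hw : w 0 * 'X_0 + w 1 * 'X_1 + w 2%:R * 'X_2%:R = 0 by rewrite -wR sum3.
have hb : w 0 * b 0 + w 1 * b 1 + w 2%:R * b 2%:R = 0 by rewrite -wB /contraction sum3.
have v0E : v 0 = 'X_1 * b 2%:R - 'X_2%:R * b 1 by [].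
have v1E : v 1 = 'X_2%:R * b 0 - 'X_0 * b 2%:R by [].
have v2E : v 2%:R = 'X_0 * b 1 - 'X_1 * b 0 by [].
have e01 : w 0 * v 1 = w 1 * v 0.
  apply/eqP; rewrite -subr_eq0; apply/eqP; rewrite v0E v1E.
  transitivity ('X_2%:R * (w 0 * b 0 + w 1 * b 1 + w 2%:R * b 2%:R) -
    b 2%:R * (w 0 * 'X_0 + w 1 * 'X_1 + w 2%:R * 'X_2%:R)); first by ring.
  by rewrite hw hb !mulr0 subrr.
have e12 : w 1 * v 2%:R = w 2%:R * v 1.
  apply/eqP; rewrite -subr_eq0; apply/eqP; rewrite v1E v2E.
  transitivity ('X_0 * (w 0 * b 0 + w 1 * b 1 + w 2%:R * b 2%:R) -
    b 0 * (w 0 * 'X_0 + w 1 * 'X_1 + w 2%:R * 'X_2%:R)); first by ring.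
  by rewrite hw hb !mulr0 subrr.
have e20 : w 2%:R * v 0 = w 0 * v 2%:R.
  apply/eqP; rewrite -subr_eq0; apply/eqP; rewrite v0E v2E.
  transitivity ('X_1 * (w 0 * b 0 + w 1 * b 1 + w 2%:R * b 2%:R) -
    b 1 * (w 0 * 'X_0 + w 1 * 'X_1 + w 2%:R * 'X_2%:R)); first by ring.
  by rewrite hw hb !mulr0 subrr.
have wv i j : w i * v j = w j * v i.
  by move: i j; apply: ord3P; apply: ord3P; rewrite ?e01 ?e12 ?e20.
have [i0 w0] := primitive_form_neq0.
have [|q hq] := primitive_colinear (mpoly_factorial w0) _ wv w0.
  move=> p [p0 p1 _]; apply: contrapT => /forallNP h.
  have /wP : forall i, exists q, w i = q * p by move=> i; exact: contrapT (h i).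
  rewrite leq_eqVlt ltnS leqn0 msize_poly_eq0.
  rewrite (negPf p0) orbF => /msize_poly1P [c c0 pE].
  by case: p1; exists (c^-1)%:MP; rewrite pE -mpolyCM mulVf ?mpolyC1.
have v0 i : v i = 0.
  suff q0 : q = 0 by rewrite hq q0 mul0r.
  apply/eqP/negPn/negP => q0.
  have vi0 : v i0 != 0 by rewrite hq mulf_neq0.
  have := msize_homog vi0 (vH i0); rewrite hq msizeM //.
  have := msize_homog w0 (wH i0); have : (0 < msize q)%N by rewrite lt0n msize_poly_eq0.
  move=> sq -> /eqP; rewrite -subn1 -addnBA // subn1 /= eq_sym => /eqP h.
  by have := leq_add sq (ltnW d3); rewrite -h; lia.
have x01 : 'X_0 * b 1 = 'X_1 * b 0 by apply/eqP; rewrite -subr_eq0 -v2E v0.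
have x12 : 'X_1 * b 2%:R = 'X_2%:R * b 1 by apply/eqP; rewrite -subr_eq0 -v0E v0.
have x20 : 'X_2%:R * b 0 = 'X_0 * b 2%:R by apply/eqP; rewrite -subr_eq0 -v1E v0.
by apply: ord3P; apply: ord3P; rewrite -/(b 0) -/(b 1) -/(b 2%:R) ?x01 ?x12 ?x20.
Qed.

Lemma lie_derivative_scalar c j :
  lie_derivative w c%:M j = (c * d.+1%:R) *: w j.
Proof.
have lf k : linear_field k (c%:M : 'M[K]_3) = c *: 'X_k.
  rewrite /linear_field (bigD1 k) //= !mxE eqxx big1 ?addr0 // => l /negPf hl.
  by rewrite !mxE eq_sym hl scale0r.
rewrite /lie_derivative /derive_along.
under eq_bigr do rewrite lf -scalerAl.
rewrite -scaler_sumr (euler_homog (wH j)) scalerA (bigD1 j) //= !mxE eqxx.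
rewrite big1 ?addr0 => [|i /negPf hi]; last by rewrite mxE hi scale0r.
by rewrite -scalerDl -[d.+1%:R]natr1 mulrDr mulr1.
Qed.

(** A nonzero scalar matrix is not isotropic: it multiplies [w] by a nonzero
    constant. *)
Lemma isotropic_contraction_inj A :
  isotropic w A -> contraction w A = 0 -> A = 0.
Proof.
move=> hA /contraction_eq0_scalar; move: (A 0 0) => c AE.
have [j wj] := primitive_form_neq0.
have := hA j; rewrite AE lie_derivative_scalar => /eqP.
rewrite scaler_eq0 (negPf wj) orbF mulf_eq0 pnatr_eq0 orbF => /eqP ->.
by rewrite raddf0.
Qed.

(** Otherwise the quotient of the two contractions would be constant. *)
Lemma isotropic_commuting_colinear A B : isotropic w A -> isotropic w B ->
  A != 0 -> commutator A B = 0 -> exists c, B = c *: A.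
Proof.
move=> hA hB A0 AB.
have fA : contraction w A != 0.
  by apply: contraNneq A0 => /(isotropic_contraction_inj hA) ->.
have [j|c fB] := wronskian_eq0_colinear (q := contraction w B) fA.
  apply/eqP; rewrite -subr_eq0 (wronskian_contraction wH wR) // AB.
  by rewrite (linear0 (contraction w)) oppr0 mul0r.
exists c; apply/eqP; rewrite -subr_eq0; apply/eqP.
apply: isotropic_contraction_inj; last first.
  by rewrite (linearB (contraction w)) (linearZ_LR (contraction w)) /= fB subrr.
move=> j; have := hA j; have := hB j; rewrite /lie_derivative => eB eA.
have E : derive_along (B - c *: A) (w j) =
    derive_along B (w j) - c *: derive_along A (w j).
  rewrite /derive_along scaler_sumr -sumrB; apply: eq_bigr => k _.
  by rewrite linearB linearZ /= mulrBl -scalerAl.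
under eq_bigr do rewrite !mxE scalerBl -scalerA.
by rewrite E sumrB -scaler_sumr addrACA eB -opprD -scalerDr eA scaler0 subr0.
Qed.

(** Combine the three identities [wronskian_contraction] with coefficients
    [f_S], [- f_T], [f_Y], for which the derivatives cancel. *)
Lemma isotropic_sl2_relation Y T S :
  isotropic w Y -> isotropic w T -> isotropic w S ->
  commutator Y T = Y -> commutator Y S = T -> commutator T S = S ->
  contraction w T ^+ 2 = 2 * (contraction w S * contraction w Y).
Proof.
move=> hY hT hS YT YS TS; have [j wj] := primitive_form_neq0.
have := wronskian_contraction wH wR j hY hT; rewrite YT => e1.
have := wronskian_contraction wH wR j hY hS; rewrite YS => e2.
have := wronskian_contraction wH wR j hT hS; rewrite TS => e3.
move: (contraction w Y) (contraction w T) (contraction w S) e1 e2 e3.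
move=> y t s; move: (mderiv j y) (mderiv j t) (mderiv j s) => y' t' s' e1 e2 e3.
apply: (mulIf wj); apply/eqP; rewrite -subr_eq0; apply/eqP.
transitivity (s * (- y * w j) - t * (- t * w j) + y * (- s * w j)); first by ring.
by rewrite -e1 -e2 -e3; ring.
Qed.
End PrimitiveForm.

(** * Representations of sl_2 on the plane *)

Section Sl2Matrices.
Context {K : numClosedFieldType}.
Variables Y T S : 'M[K]_3.
Hypotheses (Y0 : Y != 0) (YT : commutator Y T = Y) (YS : commutator Y S = T)
  (TS : commutator T S = S).

Let eTY : T * Y = Y * T - Y.
Proof. by rewrite -[X in _ - X]YT /commutator opprB addrC subrK. Qed.
Let eYS : Y * S = S * Y + T.
Proof. by rewrite -YS /commutator addrC subrK. Qed.
Let eTS : T * S = S * T + S.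
Proof. by rewrite -[X in _ + X]TS /commutator addrC subrK. Qed.

Let twoM (A B : 'M[K]_3) : A *+ 2 = B -> A = 2^-1 *: B.
Proof. by move=> <-; rewrite -scaler_nat scalerA mulVf ?scale1r ?pnatr_eq0. Qed.

(** [Y ^ 2 = 0] holds when the representation is the sum of the standard and the
    trivial ones; [4 T ^ 2] is then the projector onto the former. *)
Section SquareZero.
Hypothesis Y2 : Y * Y = 0.

Lemma sl2_square_zero_YT : Y * T = 2^-1 *: Y /\ T * Y = - (2^-1 *: Y).
Proof.
have YSY : Y * S * Y = T * Y by rewrite eYS mulrDl -mulrA Y2 mulr0 add0r.
have : Y * (Y * S) = 0 by rewrite mulrA Y2 mul0r.
rewrite eYS mulrDr mulrA YSY eTY addrAC -mulr2n => /eqP; rewrite subr_eq0 => /eqP.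
move=> /twoM e; split; first exact: e; rewrite e -[X in _ - X]scale1r -scalerBl -scaleNr.
by congr (_ *: _); field.
Qed.

Lemma sl2_square_zero_SY :
  S * Y = - (T * T + 2^-1 *: T) /\ Y * S = - (T * T) + 2^-1 *: T.
Proof.
have [e1 e2] := sl2_square_zero_YT.
have h1 : Y * T * S = 2^-1 *: (Y * S) by rewrite e1 scalerAl.
have h2 : Y * T * S = 2^-1 *: (S * Y) + T * T + (S * Y + T).
  rewrite -mulrA eTS mulrDr mulrA eYS mulrDl -mulrA e1 scalerAr.
  by rewrite -!scalerAr.
have e3 : S * Y = - (T * T + 2^-1 *: T).
  move: h2; rewrite h1 eYS scalerDr.
  move: (S * Y) (T * T) => a b h.
  have : a + (b + 2^-1 *: T) = 0.
    transitivity (2^-1 *: a + b + (a + T) - (2^-1 *: a + 2^-1 *: T)).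
      by apply/matrixP => i j; rewrite !mxE; field.
    by rewrite -h subrr.
  by move/eqP; rewrite addr_eq0 => /eqP.
split=> //; rewrite eYS e3; move: (T * T) => b.
by apply/matrixP => i j; rewrite !mxE; field.
Qed.

Lemma sl2_square_zero_SYS : S = - 2%:R *: (S * Y * S).
Proof.
have [e3 e4] := sl2_square_zero_SY.
have ttS : T * T * S = S * T * T + 2%:R *: (S * T) + S.
  rewrite -mulrA eTS mulrDr mulrA eTS mulrDl scaler_nat mulr2n; move: (S * T * T) => b.
  by rewrite !addrA.
have h : S * Y * S = S * (Y * S) by rewrite mulrA.
have ST : S * T = - (2^-1 *: S).
  move: h; rewrite e3 e4 mulNr mulrDl -scalerAl ttS eTS mulrDr mulrN -scalerAr mulrA.
  move: (S * T) (S * T * T) => b a h.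
  have : 3%:R *: (b + 2^-1 *: S) = 0.
    transitivity ((- a + 2^-1 *: b) - (- (a + 2%:R *: b + S + 2^-1 *: (b + S)))).
      by apply/matrixP => i j; rewrite !mxE; field.
    by rewrite -h subrr.
  by move/eqP; rewrite scaler_eq0 pnatr_eq0 /= addr_eq0 => /eqP.
rewrite h e4 mulrDr mulrN -scalerAr mulrA ST mulNr -scalerAl ST.
by apply/matrixP => i j; rewrite !mxE; field.
Qed.

Lemma sl2_square_zero_rank1 : exists (u : 'cV[K]_3) (v : 'rV[K]_3), Y = u *m v.
Proof.
have : \rank Y = 1%N.
  have := mulmx0_rank_max Y2; have : (0 < \rank Y)%N by rewrite lt0n mxrank_eq0.
  lia.
move: (col_base Y) (row_base Y) (mulmx_base Y) => u v; move: u v => + + + e.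
by rewrite e => u v <-; exists u, v.
Qed.

(** By rank one, [f Y x] and [f S x] split as products of a factor in [f] and
    one in [x], and so do [f S Y x] and [f Y S x] with the same four factors.
    As [S Y] and [Y S] are polynomials in [T], the right-hand side of
    the hypothesis is [(f T x) ^ 2 - 4 (f T ^ 2 x) ^ 2]. *)
Lemma sl2_square_zero_quadric (x : 'cV[K]_3) (f : 'rV[K]_3) :
  (f *m T *m x) 0 0 ^+ 2 = 2 * ((f *m S *m x) 0 0 * (f *m Y *m x) 0 0) ->
  (f *m (T * T) *m x) 0 0 = 0.
Proof.
have [u [v uv]] := sl2_square_zero_rank1.
have [e3 e4] := sl2_square_zero_SY; have e5 := sl2_square_zero_SYS.
have m11 (a b : 'M[K]_1) : (a *m b) 0 0 = a 0 0 * b 0 0 by rewrite mxE big_ord1.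
pose q A := (f *m A *m x) 0 0.
have qD A B : q (A + B) = q A + q B by rewrite /q mulmxDr mulmxDl mxE.
have qN A : q (- A) = - q A by rewrite /q mulmxN mulNmx mxE.
have qZ c A : q (c *: A) = c * q A by rewrite /q -scalemxAr -scalemxAl mxE.
have qY : q Y = (f *m u) 0 0 * (v *m x) 0 0 by rewrite /q uv mulmxA -[_ *m x]mulmxA m11.
have qSY : q (S * Y) = (f *m S *m u) 0 0 * (v *m x) 0 0.
  by rewrite /q uv -mulmxE !mulmxA -[_ *m x]mulmxA m11.
have qYS : q (Y * S) = (f *m u) 0 0 * (v *m S *m x) 0 0.
  by rewrite /q uv -mulmxE !mulmxA -[f *m u *m v *m S]mulmxA -[_ *m x]mulmxA m11.
have qS : q S = - 2%:R * ((f *m S *m u) 0 0 * (v *m S *m x) 0 0).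
  rewrite {1}e5 qZ /q uv -mulmxE !mulmxA -[f *m S *m u *m v *m S]mulmxA.
  by rewrite -[_ *m x]mulmxA m11.
rewrite -/(q T) -/(q S) -/(q Y) -/(q (T * T)) => h.
have : q T ^+ 2 = - 4%:R * (q (S * Y) * q (Y * S)) by rewrite h qS qY qSY qYS; ring.
rewrite e3 e4 qN !qD qN !qZ => h'.
have : 4%:R * q (T * T) ^+ 2 = 0.
  transitivity (q T ^+ 2 -
    (- 4%:R * (- (q (T * T) + 2^-1 * q T) * (- q (T * T) + 2^-1 * q T)))).
    by field.
  by rewrite -h' subrr.
by move/eqP; rewrite mulf_eq0 pnatr_eq0 /= expf_eq0 /= => /eqP.
Qed.

(** Otherwise [T ^ 2 = 1 / 4], and then the trace of [S Y] is [- 3 / 4] because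
    [T] has trace zero, whereas [S Y] has rank one and
    [(S Y) ^ 2 = - (1 / 2) S Y]. *)
Lemma sl2_square_zero_not_scalar c : T * T <> c%:M.
Proof.
move=> tt; have [e1 e2] := sl2_square_zero_YT; have [e3 e4] := sl2_square_zero_SY.
have cE : c = 4%:R^-1.
  have : Y * (T * T) = 4%:R^-1 *: Y.
    by rewrite mulrA e1 -scalerAl e1 scalerA -invfM -natrM.
  rewrite tt -mulmxE mul_mx_scalar => /eqP; rewrite -subr_eq0 -scalerBl scaler_eq0.
  by rewrite (negPf Y0) orbF subr_eq0 => /eqP.
have [u [v uv]] := sl2_square_zero_rank1.
have trT : \tr T = 0.
  by rewrite -YS /commutator linearB /= -!mulmxE mxtrace_mulC subrr.
have SY2 : S * Y * (S * Y) = - 2^-1 *: (S * Y).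
  rewrite e3 mulrNN mulrDl !mulrDr -!scalerAl -!scalerAr tt -!mulmxE !mul_scalar_mx.
  rewrite !mul_mx_scalar cE.
  by apply/matrixP => i j; rewrite !mxE; case: (i == j); rewrite ?mulr1n ?mulr0n; field.
have sq : S * Y * (S * Y) = \tr (S * Y) *: (S * Y).
  have -> : S * Y = S *m u *m v by rewrite uv -mulmxE mulmxA.
  move: (S *m u) => s; rewrite -mulmxE mulmxA -[s *m v *m s]mulmxA.
  rewrite [v *m s]mx11_scalar mul_mx_scalar -scalemxAl [\tr (s *m v)]mxtrace_mulC.
  by rewrite /mxtrace big_ord1.
have tr : \tr (S * Y) = - (3%:R / 4%:R).
  rewrite e3 tt cE linearN linearD linearZ /= trT mulr0 addr0 mxtrace_scalar.
  by congr (- _); rewrite -mulr_natl; field.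
have SY0 : S * Y = 0.
  move: sq; rewrite SY2 tr => /eqP; rewrite -subr_eq0 -scalerBl scaler_eq0.
  move=> /orP [|/eqP //]; rewrite (_ : _ - _ = 4%:R^-1); last by field.
  by rewrite invr_eq0 pnatr_eq0.
have : T = - 2^-1 *: 1.
  have h2 : 2^-1 != 0 :> K by rewrite invr_eq0 pnatr_eq0.
  apply: (scalerI h2).
  move/eqP: e3; rewrite SY0 eq_sym oppr_eq0 addrC addr_eq0 tt cE => /eqP ->.
  apply/matrixP => i j; rewrite !mxE.
  by case: (i == j); rewrite ?mulr1n ?mulr0n; field; rewrite ?pnatr_eq0.
move=> TE; case/eqP: Y0; rewrite -YT TE /commutator -scalerAr -scalerAl.
by rewrite mulr1 mul1r subrr.
Qed.
End SquareZero.

(** [Y ^ 3 = 0] forces [T Y ^ 2 = - Y ^ 2], so the image of [Y ^ 2] consists of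
    vectors killed by [Y] of weight [-1] for [T]; they generate the irreducible
    representation under [S]. *)
Lemma sl2_square_neq0_basis : Y * Y != 0 ->
  exists b : 'I_3 -> 'cV[K]_3, [/\ b 0 != 0,
    [/\ Y *m b 0 = 0, Y *m b 1 = - b 0 & Y *m b 2%:R = - b 1],
    [/\ T *m b 0 = - b 0, T *m b 1 = 0 & T *m b 2%:R = b 2%:R]
    & [/\ S *m b 0 = b 1, S *m b 1 = b 2%:R & S *m b 2%:R = 0]].
Proof.
move=> Y2.
have Y3 : Y * Y * Y = 0 by rewrite -expr2 -exprSr; exact: commutator_eigen_nilpotent YT.
have S3 : S * S * S = 0.
  rewrite -expr2 -exprSr; apply: (@commutator_eigen_nilpotent _ _ _ (- T)).
  by rewrite /commutator mulrN mulNr opprK addrC; exact: TS.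
have TYY : T * (Y * Y) = Y * Y * T - (Y * Y) *+ 2.
  by rewrite mulrA eTY mulrBl -[Y * T * Y]mulrA eTY mulrBr mulrA mulr2n opprD addrA.
have Y2T : Y * Y * T = Y * Y.
  have : Y * Y * Y * S = 0 by rewrite Y3 mul0r.
  have -> : Y * Y * Y * S = Y * Y * Y * 0 + T * (Y * Y) + (Y * Y * T) *+ 2 - Y * Y.
    have h1 : Y * Y * S = S * (Y * Y) + Y * T *+ 2 - Y.
      rewrite -mulrA eYS mulrDr mulrA eYS mulrDl -[S * Y * Y]mulrA eTY.
      move: (S * (Y * Y)) (Y * T) => a b.
      by apply/matrixP => i j; rewrite !mxE; ring.
    have -> : Y * Y * Y * S = Y * (Y * Y * S) by rewrite !mulrA.
    rewrite h1 mulrBr mulrDr [Y * (S * _)]mulrA eYS mulrDl.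
    rewrite -[S * Y * (Y * Y)]mulrA [Y * (Y * Y)]mulrA Y3 mulr0 add0r mulr0 add0r.
    by rewrite mulrnAr [Y * (Y * T)]mulrA.
  rewrite mulr0 add0r TYY; move: (Y * Y) (Y * Y * T) => c a h.
  have : 3%:R *: (a - c) = 0.
    by rewrite -h; apply/matrixP => i j; rewrite !mxE; ring.
  by move/eqP; rewrite scaler_eq0 pnatr_eq0 /= subr_eq0 => /eqP.
have {}TYY : T * (Y * Y) = - (Y * Y).
  by rewrite TYY Y2T mulr2n opprD addrA subrr add0r.
have [j uj] : exists j, col j (Y * Y) != 0.
  apply: contrapT => /forallNP h; case/eqP: Y2; apply/matrixP => i j.
  have /negP/negPn/eqP/colP/(_ i) := h j; by rewrite !mxE.
pose u := col j (Y * Y).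
have Mu (A : 'M[K]_3) : A *m u = col j (A * (Y * Y)) by rewrite /u -mulmxE !colE mulmxA.
have Yu : Y *m u = 0 by rewrite Mu mulrA Y3 col0.
have Tu : T *m u = - u by rewrite Mu TYY linearN.
have TSm (v : 'cV[K]_3) : T *m (S *m v) = S *m (T *m v) + S *m v.
  by rewrite !mulmxA !mulmxE eTS mulmxDl.
have YSm (v : 'cV[K]_3) : Y *m (S *m v) = S *m (Y *m v) + T *m v.
  by rewrite !mulmxA !mulmxE eYS mulmxDl.
have TSu : T *m (S *m u) = 0 by rewrite TSm Tu mulmxN addNr.
have YSu : Y *m (S *m u) = - u by rewrite YSm Yu mulmx0 add0r.
exists (fun i => if i == 0 then u else if i == 1 then S *m u else S *m (S *m u)).
split=> //=; split=> //; rewrite ?TSu ?YSu //.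
- by rewrite YSm YSu mulmxN TSu addr0.
- by rewrite TSm TSu mulmx0 add0r.
- by rewrite !mulmxA !mulmxE S3 mul0mx.
Qed.
End Sl2Matrices.

(** The left-hand side has even degree and the right-hand side odd degree. *)
Lemma square_mul_linear_neq (K : fieldType) (a u : {poly K}) c z :
  a != 0 -> z != 0 -> u ^+ 2 <> a ^+ 2 * (c%:P + z%:P * 'X).
Proof.
move=> a0 z0 e.
have s2 : size (c%:P + z%:P * 'X) = 2%N.
  by rewrite addrC size_MXaddC polyC_eq0 (negPf z0) size_polyC z0.
have l0 : c%:P + z%:P * 'X != 0 by rewrite -size_poly_eq0 s2.
have u0 : u != 0.
  apply: contra_eq_neq e => ->; rewrite expr0n eq_sym mulf_neq0 // expf_neq0 //.
have := congr1 (fun p : {poly K} => size p) e.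
rewrite !expr2 !size_mul ?mulf_neq0 // s2.
have := u0; have := a0; rewrite -!size_poly_gt0.
by move: (size a) (size u) => [|m] [|k] // _ _; rewrite !addnS !addSn /=; lia.
Qed.

Lemma on_line_linear_field (K : numClosedFieldType) (x v : 'I_3 -> K) k (B : 'M[K]_3) :
  on_line x v (linear_field k B) =
  (\sum_l B k l * x l)%:P + (\sum_l B k l * v l)%:P * 'X.
Proof.
rewrite /on_line /linear_field raddf_sum /= !rmorph_sum mulr_suml -big_split.
apply: eq_bigr => l _; rewrite mmapZ mmapX mmap1U /= !polyCM; ring.
Qed.

Section NoSl2.
Context {K : numClosedFieldType} {w : 'I_3 -> {mpoly K[3]}} {d : nat}.
Hypothesis wH : forall i, w i \is d.-homog.
Hypothesis wR : \sum_(i < 3) w i * 'X_i = 0.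
Hypothesis wP : forall p, (forall i, exists q, w i = q * p) -> (msize p <= 1)%N.
Hypothesis d3 : (2 < d)%N.
Variables Y T S : 'M[K]_3.
Hypotheses (Y0 : Y != 0) (YT : commutator Y T = Y) (YS : commutator Y S = T)
  (TS : commutator T S = S).
Hypothesis quad : contraction w T ^+ 2 = 2 * (contraction w S * contraction w Y).

Let f (v : 'I_3 -> K) : 'rV[K]_3 := \row_i (w i).@[v].
Let col_of (v : 'I_3 -> K) : 'cV[K]_3 := \col_i v i.

Let meval_contractionE B v : (contraction w B).@[v] = (f v *m B *m col_of v) 0 0.
Proof.
rewrite meval_contraction -mulmxA mxE; apply: eq_bigr => i _; rewrite !mxE.
by congr (_ * _); apply: eq_bigr => k _; rewrite mxE.
Qed.

(** Otherwise [w] annihilates [T ^ 2 x], with [T ^ 2] not scalar. *)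
Lemma sl2_relation_square_neq0 : Y * Y != 0.
Proof.
apply/eqP => Y2.
apply: (sl2_square_zero_not_scalar Y0 YT YS TS Y2 (c := (T * T) 0 0)).
apply: (contraction_eq0_scalar wH wR wP d3).
apply: mpoly_eval_inj => v; rewrite meval_contractionE meval0.
apply: (sl2_square_zero_quadric Y0 YT YS TS Y2).
have := congr1 (meval v) quad.
by rewrite rmorphXn !rmorphM /= !meval_contractionE -mpolyC_nat mevalC.
Qed.

(** In the coordinates [X k] of points and [A k] of covectors adapted to the
    irreducible representation, the relation becomes [A 1 ^ 2 = 2 A 0 A 2]
    modulo [w x = 0]. The equation
    [X 0 * A 0 + X 1 * A 1 + X 2 * A 2 = 0] is then quadratic in the parameter
    of this conic, so its discriminant [X 1 ^ 2 - 2 X 0 X 2] would be a square.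
    It is not: it has degree one along general lines directed by [b 0]. *)
Lemma no_sl2_relation : False.
Proof.
have [b [b0 [Yb0 Yb1 Yb2] [Tb0 Tb1 Tb2] [Sb0 Sb1 Sb2]]] :=
  sl2_square_neq0_basis YT YS TS sl2_relation_square_neq0.
pose P := \matrix_(i, j) b j i 0.
have Pb c : P *m c = c 0 0 *: b 0 + c 1 0 *: b 1 + c 2%:R 0 *: b 2%:R.
  apply/colP => i; rewrite mxE sum3 !mxE; ring.
have Pu : P \in unitmx.
  rewrite unitmxE unitfE -det_tr; apply/det0P => -[c c0 /(congr1 trmx)].
  rewrite trmx_mul trmxK trmx0 Pb !mxE => e.
  have e2 : c 0 2%:R = 0.
    have := congr1 (mulmx Y \o mulmx Y) e; rewrite /= !mulmx0 !mulmxDr -!scalemxAr.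
    rewrite Yb0 Yb1 Yb2 !mulmxN Yb0 Yb1 mulmx0 oppr0 !scaler0 !add0r opprK => /eqP.
    by rewrite scaler_eq0 (negPf b0) orbF => /eqP.
  have e1 : c 0 1 = 0.
    have := congr1 (mulmx Y) e; rewrite e2 scale0r addr0 mulmx0 mulmxDr -!scalemxAr.
    rewrite Yb0 Yb1 scaler0 add0r => /eqP.
    by rewrite scaler_eq0 oppr_eq0 (negPf b0) orbF => /eqP.
  move/eqP: e; rewrite e1 e2 !scale0r !addr0 scaler_eq0 (negPf b0) orbF => /eqP e0.
  by case/eqP: c0; apply/rowP; apply: ord3P; rewrite mxE.
pose L := invmx P.
have PL : P *m L = 1%:M by rewrite mulmxV.
have LP : L *m P = 1%:M by rewrite mulVmx.
pose X k := linear_field k L.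
pose A k : {mpoly K[3]} := \sum_i b k i 0 *: w i.
have XE k v : (X k).@[v] = (L *m col_of v) k 0.
  by rewrite meval_linear_field mxE; apply: eq_bigr => l _; rewrite !mxE.
have AE k v : (A k).@[v] = (f v *m b k) 0 0.
  rewrite raddf_sum mxE; apply: eq_bigr => l _; by rewrite /= mevalZ !mxE mulrC.
have xE v : col_of v = (X 0).@[v] *: b 0 + (X 1).@[v] *: b 1 + (X 2%:R).@[v] *: b 2%:R.
  by rewrite !XE -Pb mulmxA PL mul1mx.
have qE B v : (contraction w B).@[v] = (X 0).@[v] * (f v *m (B *m b 0)) 0 0 +
    (X 1).@[v] * (f v *m (B *m b 1)) 0 0 + (X 2%:R).@[v] * (f v *m (B *m b 2%:R)) 0 0.
  rewrite meval_contractionE -mulmxA xE !mulmxDr -!scalemxAr.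
  by move: (_ *m _) (_ *m _) (_ *m _) => a1 a2 a3; rewrite !mxE.
have N00 (M : 'M[K]_1) : (- M) 0 0 = - M 0 0 by rewrite mxE.
have O00 : (0 : 'M[K]_1) 0 0 = 0 by rewrite mxE.
have eT : contraction w T = X 2%:R * A 2%:R - X 0 * A 0.
  apply: mpoly_eval_inj => v; rewrite qE mevalB !mevalM !AE Tb0 Tb1 Tb2.
  by rewrite mulmxN mulmx0 N00 O00; ring.
have eS : contraction w S = X 0 * A 1 + X 1 * A 2%:R.
  apply: mpoly_eval_inj => v; rewrite qE mevalD !mevalM !AE Sb0 Sb1 Sb2.
  by rewrite mulmx0 O00 mulr0 addr0.
have eY : contraction w Y = - (X 1 * A 0) - X 2%:R * A 1.
  apply: mpoly_eval_inj => v; rewrite qE mevalB mevalN !mevalM !AE Yb0 Yb1 Yb2.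
  by rewrite !mulmxN mulmx0 !N00 O00; ring.
have eR : X 0 * A 0 + X 1 * A 1 + X 2%:R * A 2%:R = 0.
  apply: mpoly_eval_inj => v; have := qE 1%:M v; rewrite !mul1mx -!AE -!mevalM -!mevalD => <-.
  rewrite meval0 -(meval0 v) -wR meval_contraction raddf_sum.
  apply: eq_bigr => i _; rewrite /= mevalM mevalXU (bigD1 i) //= mxE eqxx mul1r.
  by rewrite big1 ?addr0 // => k /negPf hk; rewrite mxE eq_sym hk mul0r.
have Xb k j : (X k).@[fun i => b j i 0] = (k == j)%:R.
  rewrite XE (_ : col_of _ = P *m delta_mx j 0); last first.
    by apply/colP => i; rewrite -colE !mxE.
  by rewrite mulmxA LP mul1mx mxE eqxx andbT.
have Xneq0 k : X k != 0.
  by apply/eqP => h; have /eqP := Xb k k; rewrite h meval0 eqxx eq_sym oner_eq0.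
have disc : A 1 ^+ 2 = 2 * (A 0 * A 2%:R).
  have Q0 : 2 * (X 0 * X 2%:R) - X 1 ^+ 2 != 0.
    apply/eqP => h; have /eqP := congr1 (meval (fun i => b 1 i 0)) h.
    rewrite mevalB mevalM mevalM rmorphXn /= !Xb !mulr0 sub0r expr1n meval0.
    by rewrite oppr_eq0 oner_eq0.
  apply/eqP; rewrite -subr_eq0; apply/eqP; apply: (mulfI Q0); rewrite mulr0.
  transitivity (contraction w T ^+ 2 - 2 * (contraction w S * contraction w Y) -
    (X 0 * A 0 + X 1 * A 1 + X 2%:R * A 2%:R) ^+ 2).
    by rewrite eT eS eY; ring.
  by rewrite quad eR subrr expr0n subr0.
have A1 : A 1 != 0.
  apply/eqP => A1.
  have : 2 * (A 0 * A 2%:R) = 0 by rewrite -disc A1 expr0n.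
  move=> /eqP; rewrite mulf_eq0 -mpolyC_nat mpolyC_eq0 pnatr_eq0 /= mulf_eq0 => A02.
  have [A00 A20] : A 0 = 0 /\ A 2%:R = 0.
    move/eqP: eR; rewrite A1 mulr0 addr0.
    case: (orP A02) => /eqP h; rewrite h mulr0 ?add0r ?addr0 mulf_eq0;
      by rewrite (negPf (Xneq0 _)) /= => /eqP.
  case: (primitive_form_neq0 wP) => i; case/negP; apply/eqP.
  have -> : w i = \sum_k L k i *: A k.
    apply: mpoly_eval_inj => v; rewrite raddf_sum /=.
    under eq_bigr do rewrite mevalZ AE.
    transitivity ((f v *m (P *m L)) 0 i); first by rewrite PL mulmx1 mxE.
    rewrite mulmxA mxE; apply: eq_bigr => k _; rewrite mulrC; congr (_ * _).
    by rewrite !mxE; apply: eq_bigr => l _; rewrite !mxE.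
  by rewrite sum3 A1 A00 A20 !scaler0 !addr0.
have fin : (2 * (X 2%:R * A 2%:R) + X 1 * A 1) ^+ 2 =
    A 1 ^+ 2 * (X 1 * X 1 - X 0 * X 2%:R - X 0 * X 2%:R).
  apply/eqP; rewrite -subr_eq0; apply/eqP.
  transitivity (4%:R * (X 2%:R * A 2%:R) * (X 0 * A 0 + X 1 * A 1 + X 2%:R * A 2%:R) +
    2 * (X 0 * X 2%:R) * (A 1 ^+ 2 - 2 * (A 0 * A 2%:R))); first by ring.
  by rewrite eR disc subrr !mulr0 addr0.
have [p] := mpoly_neq0_eval (mulf_neq0 A1 (Xneq0 2%:R)).
rewrite mevalM mulf_eq0 => /norP [pA pX].
pose G := on_line p (fun i => b 0 i 0).
have GM a c : G (a * c) = G a * G c by rewrite /G /on_line rmorphM.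
have GX k : G (X k) = ((X k).@[p])%:P + ((k == 0)%:R)%:P * 'X.
  by rewrite /G on_line_linear_field -!meval_linear_field Xb.
have GB a c : G (a - c) = G a - G c by rewrite /G /on_line rmorphB.
have G2 a : G (a ^+ 2) = G a ^+ 2 by rewrite !expr2 GM.
have G0 : G (X 0) = ((X 0).@[p])%:P + 'X by rewrite GX polyC1 mul1r.
have G1 : G (X 1) = ((X 1).@[p])%:P by rewrite GX polyC0 mul0r addr0.
have G3 : G (X 2%:R) = ((X 2%:R).@[p])%:P by rewrite GX polyC0 mul0r addr0.
have := congr1 G fin; rewrite !G2 GM !GB !GM G0 G1 G3.
set a := G (A 1); set x := (X 0).@[p]; set y := (X 1).@[p]; set z := (X 2%:R).@[p].
move: (G _) => u.
have a0 : a != 0.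
  apply: contraNneq pA => h.
  have := horner_on_line p (fun i => b 0 i 0) (A 1) 0.
  rewrite -/(G _) -/a h horner0 => /esym/eqP.
  by rewrite (meval_eq (v2 := p)) // => i; rewrite mulr0 addr0.
have z0 : - (z + z) != 0.
  by rewrite oppr_eq0 -mulr2n mulrn_eq0.
have -> : y%:P * y%:P - (x%:P + 'X) * z%:P - (x%:P + 'X) * z%:P =
    (y * y - x * z - x * z)%:P + (- (z + z))%:P * 'X.
  by rewrite !polyCB !polyCM polyCN polyCD; ring.
exact: square_mul_linear_neq.
Qed.
End NoSl2.

(** * The isotropy algebra has dimension at most two *)

Section IsotropyAlgebra.
Context {K : numClosedFieldType} {d : nat}.
Implicit Types (w : one_form K d.+1) (B : 'M[K]_3).

Lemma lie_derivative_homog w B j :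
  lie_derivative (fun i => (w i : {mpoly K[3]})) B j \is d.+1.-homog.
Proof.
apply: rpredD; apply: rpred_sum => k _; last exact/dhomogZ/dhomog_is_dhomog.
apply: (@dhomogM _ _ _ 1 _ d); first exact: linear_field_homog.
by apply: mderiv_homog; exact: dhomog_is_dhomog.
Qed.

Definition lie_form w B : one_form K d.+1 :=
  [ffun j => DHomog (lie_derivative_homog w B j)].

Lemma lie_form_is_linear w : linear (lie_form w).
Proof.
move=> c A B; apply/ffunP => j; rewrite !ffunE; apply: val_inj => /=.
rewrite /lie_derivative scalerDr addrACA; congr (_ + _).
  rewrite /derive_along scaler_sumr -big_split; apply: eq_bigr => k _ /=.
  by rewrite linearP mulrDl -scalerAl.
rewrite scaler_sumr -big_split; apply: eq_bigr => k _ /=.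
by rewrite !mxE scalerDl scalerA.
Qed.
HB.instance Definition _ w := GRing.isLinear.Build K 'M[K]_3 (one_form K d.+1) *:%R
  (lie_form w) (lie_form_is_linear w).

Lemma lie_form_eq0 w B :
  lie_form w B = 0 <-> isotropic (fun i => (w i : {mpoly K[3]})) B.
Proof.
split=> [h j|h].
  by have := congr1 (fun v : one_form K d.+1 => val (v j)) h; rewrite !ffunE.
by apply/ffunP => j; rewrite !ffunE; apply: val_inj; exact: h.
Qed.

Variable w : one_form K d.+1.
Hypothesis wE : euler_contraction w = 0.
Hypothesis wP : no_common_factor w.
Hypothesis d2 : (1 < d)%N.
Let u i : {mpoly K[3]} := w i.
Let uH i : u i \is d.+1.-homog. Proof. exact: dhomog_is_dhomog. Qed.

(** A larger isotropy algebra would contain an [sl_2], which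
    [no_sl2_relation] excludes. *)
Theorem isotropy_dim : (\dim (lker (linfun (lie_form w))) <= 2)%N.
Proof.
rewrite leqNgt; apply/negP => /exists_sl2_triple H.
have gE B : (B \in lker (linfun (lie_form w))) <-> isotropic u B.
  rewrite memv_ker lfunE /=; split=> [/eqP/lie_form_eq0 //|h].
  exact/eqP/lie_form_eq0.
have [A B /gE hA /gE hB|A B /gE hA /gE hB A0 AB|
  Y [T [S [[/gE hY /gE hT /gE hS] Y0 YT YS TS]]]] := H.
- exact/gE/isotropic_commutator.
- apply/vlineP; exact: (isotropic_commuting_colinear uH wE wP d2 hA hB A0 AB).
- apply: (no_sl2_relation uH wE wP d2 Y0 YT YS TS).
  exact: (isotropic_sl2_relation uH wE wP hY hT hS YT YS TS).
Qed.

(** The rank of [B |-> lie_form w B] is at least [9 - 2], and the first matrix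
    may be the identity since it multiplies [w] by a nonzero constant. *)
Lemma exists_free_lie_forms : exists B : 'I_7 -> 'M[K]_3,
  B ord0 = 1%:M /\ exists l : 'I_7 -> {linear one_form K d.+1 -> K^o},
    forall i j, l i (lie_form w (B j)) = (i == j)%:R.
Proof.
pose f : 'Hom('M[K]_3, one_form K d.+1) := linfun (lie_form w).
pose e0 := lie_form w 1%:M.
have e0U : e0 \in limg f by rewrite -[e0](lfunE (lie_form w)); exact: memv_img (memvf _).
have e00 : e0 != 0.
  apply/eqP => /lie_form_eq0 h; have [j] := primitive_form_neq0 wP.
  by case/negP; have := h j; rewrite (lie_derivative_scalar uH) => /eqP;
     rewrite scaler_eq0 mul1r pnatr_eq0 /=.
pose U := (limg f :\: <[e0]>)%VS.
pose s := e0 :: vbasis U.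
have fs : free s.
  rewrite /s -cat1s cat_free; apply/and3P; split.
  - by rewrite seq1_free.
  - exact: basis_free (vbasisP _).
  - apply/directv_addP; rewrite (span_basis (vbasisP U)) span_seq1.
    by rewrite capvC; exact: capv_diff.
have ss : (7 <= size s)%N.
  rewrite /= size_tuple.
  have := limg_ker_dim f fullv; rewrite capfv dimvf /=.
  have := isotropy_dim; rewrite -/f.
  have -> : dim 'M[K]_3 = 9 by [].
  have := dimv_cap_compl (limg f) <[e0]>%VS; rewrite -/U.
  have : (\dim (limg f :&: <[e0]>) <= 1)%N.
    by rewrite (leq_trans (dimvS (capvSr _ _))) // dim_vline leq_b1.
  lia.
have sU i : s`_i \in limg f.
  have [hi|hi] := ltnP i (size s); last by rewrite nth_default ?mem0v.
  have : s`_i \in s by rewrite mem_nth.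
  rewrite inE => /orP [/eqP -> //|/vbasis_mem]; apply: (subvP (diffvSl _ _)).
exists (fun i => if i == ord0 then 1%:M else (f^-1)%VF s`_i); split; first by rewrite eqxx.
pose ws := widen_ord ss.
exists (fun i => coord (in_tuple s) (ws i)) => i j.
have -> : lie_form w (if j == ord0 then 1%:M else (f^-1)%VF s`_j) = s`_(ws j).
  case: eqVneq => [->|j0] //.
  by rewrite -[LHS](lfunE (lie_form w)) -/f limg_lfunVK.
have := @coord_free _ _ _ (in_tuple s) (ws j) (ws i) fs; rewrite /= => ->; congr (_%:R).
by rewrite -!val_eqE eq_sym.
Qed.

End IsotropyAlgebra.

(** * The pullback as a polynomial map *)

Section FormFunctions.
Context {K : numFieldType} {n : nat}.
Notation pt := ('I_n -> K).

Definition form_fun e (g : pt -> K) :=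
  exists2 p : {mpoly K[n]}, p \is e.-homog & forall s, g s = p.@[s].

Lemma form_fun0 e : form_fun e (fun=> 0).
Proof. by exists 0 => [|s]; rewrite ?meval0 // rpred0. Qed.

Lemma form_funZ e c g : form_fun e g -> form_fun e (fun s => c * g s).
Proof.
by case=> p hp gE; exists (c *: p) => [|s]; rewrite ?mevalZ ?gE //; exact: dhomogZ.
Qed.

Lemma form_fun_sum e (I : Type) (r : seq I) (P : pred I) (g : I -> pt -> K) :
  (forall i, form_fun e (g i)) -> form_fun e (fun s => \sum_(i <- r | P i) g i s).
Proof.
move=> H; have /choice [p hp] : forall i, exists p : {mpoly K[n]},
    p \is e.-homog /\ forall s, g i s = p.@[s].
  by move=> i; case: (H i) => p; exists p.
exists (\sum_(i <- r | P i) p i) => [|s].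
  by apply: rpred_sum => i _; case: (hp i).
by rewrite raddf_sum; apply: eq_bigr => i _; case: (hp i).
Qed.

Lemma form_funM a b g h :
  form_fun a g -> form_fun b h -> form_fun (a + b) (fun s => g s * h s).
Proof.
move=> [p hp gE] [q hq hE]; exists (p * q) => [|s]; first exact: dhomogM.
by rewrite mevalM gE hE.
Qed.

Lemma form_fun_ext e g h : g =1 h -> form_fun e g -> form_fun e h.
Proof. by move=> gh [p hp gE]; exists p => // s; rewrite -gh. Qed.

Definition form_family e (G : pt -> {mpoly K[3]}) :=
  forall m, form_fun e (fun s => (G s)@_m).

Lemma form_familyM a b G H :
  form_family a G -> form_family b H -> form_family (a + b) (fun s => G s * H s).
Proof.
move=> hG hH m; apply: form_fun_ext (fun s => esym (mcoeffM _ _ _)) _.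
by apply: form_fun_sum => k; exact: form_funM.
Qed.

Lemma form_family_comp (A : pt -> 'M[K]_3) d (p : {mpoly K[3]}) :
  (forall i k, form_fun 1 (fun s => A s i k)) -> p \is d.-homog ->
  form_family d (fun s => p \mPo linear_map (A s)).
Proof.
move=> hA /dhomogP hp m.
apply: (@form_fun_ext _ (fun s => \sum_(k <- msupp p)
    (if mdeg k == d then p@_k * ('X_[k] \mPo linear_map (A s))@_m else 0))).
  move=> s; rewrite [RHS]/= comp_mpolyEX raddf_sum /= big_seq [RHS]big_seq.
  by apply: eq_bigr => k /hp /= ->; rewrite eqxx mcoeffZ.
apply: form_fun_sum => k; case: eqVneq => [<-|_]; last exact: form_fun0.
apply: form_funZ.
have H1 : form_family 0 (fun=> 1).
  move=> l; exists (1@_l)%:MP; last by move=> s; rewrite mevalC.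
  by rewrite -[X in X%:MP]mulr1 mpolyCM mpolyC1 mul_mpolyC; apply: dhomogZ; exact: dhomog1.
have HX i : form_family 1 (fun s => tnth (linear_map (A s)) i).
  move=> l; apply: (@form_fun_ext _ (fun s => \sum_k' ('X_k' : {mpoly K[3]})@_l * A s i k')).
    move=> s; rewrite tnth_mktuple raddf_sum; apply: eq_bigr => k' _.
    by rewrite /= mcoeffZ mulrC.
  by apply: form_fun_sum => k'; exact: form_funZ.
have ext e G H : G =1 H -> form_family e G -> form_family e H.
  by move=> GH hG l; apply: form_fun_ext (hG l) => s; rewrite GH.
have HP G e l : form_family e G -> form_family (e * l) (fun s => G s ^+ l).
  move=> hG; elim: l => [|l ih]; first by rewrite muln0.
  rewrite mulnS; apply: ext (form_familyM hG ih) => s; by rewrite exprS.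
rewrite mdegE; apply: form_fun_ext (fun s => congr1 (mcoeff m) (esym (comp_mpolyX k _))) _.
move: m; elim: (index_enum _) => [|i r ih].
  by rewrite big_nil; apply: ext H1 => s; rewrite big_nil.
rewrite big_cons.
have h := HP _ _ (k i) (HX i); rewrite mul1n in h.
by apply: ext (form_familyM h ih) => s; rewrite big_cons.
Qed.

End FormFunctions.

(** Expand [v] on monomial forms; it suffices to know the pullback coefficient
    by coefficient. *)
Lemma linear_form_mcoeff (K : fieldType) d (l : {linear one_form K d -> K^o}) :
  exists c : 'I_3 -> 'X_{1..3 < d.+1} -> K, forall v : one_form K d,
    l v = \sum_j \sum_m c j m * (v j : {mpoly K[3]})@_m.
Proof.
pose E (j : 'I_3) (m : 'X_{1..3}) : one_form K d :=
  [ffun j' => if j' == j then indhomog d ('X_[m] : {mpoly K[3]}) else 0].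
exists (fun j m => if mdeg m == d then l (E j m) else 0) => v.
have {1}-> : v = \sum_j \sum_(m : 'X_{1..3 < d.+1})
    (if mdeg m == d then (v j : {mpoly K[3]})@_m else 0) *: E j m.
  apply/ffunP => j; rewrite sum_ffunE (bigD1 j) //= sum_ffunE [X in _ + X]big1 ?addr0.
    apply: val_inj; rewrite [RHS](raddf_sum (@mpoly_of_dhomog 3 K d)) /=.
    rewrite [LHS](mpolywE (k := d.+1)).
      apply: eq_bigr => m _; rewrite !ffunE eqxx /=; case: eqVneq => [hm|hm].
        by rewrite /indhomog insubdK // unfold_in /= dhomogX; apply/eqP.
      by rewrite scale0r (dhomog_nemf_coeff (dhomog_is_dhomog (v j)) hm) scale0r.
    have [->|v0] := eqVneq (val (v j)) 0; first by rewrite msize0.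
    by rewrite (msize_homog v0 (dhomog_is_dhomog _)).
  move=> i /negPf hi; rewrite sum_ffunE big1 // => m _.
  by rewrite !ffunE [j == i]eq_sym hi scaler0.
rewrite linear_sum; apply: eq_bigr => j _; rewrite linear_sum; apply: eq_bigr => m _.
case: eqVneq => _; last by rewrite scale0r (linear0 l) mul0r.
by rewrite linearZ /= mulrC.
Qed.

Lemma form_fun_pullback (K : numFieldType) n (A : ('I_n -> K) -> 'M[K]_3) d
    (w : one_form K d) (l : {linear one_form K d -> K^o}) :
  (forall i k, form_fun 1 (fun s => A s i k)) ->
  form_fun d.+1 (fun s => l (pullback (A s) w)).
Proof.
move=> hA; have [c lE] := linear_form_mcoeff l.
apply: form_fun_ext (fun s => esym (lE _)) _.
apply: form_fun_sum => j; apply: form_fun_sum => m; apply: form_funZ.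
under eq_fun do rewrite ffunE /= /pullback_coef raddf_sum /=.
apply: form_fun_sum => i; under eq_fun do rewrite mcoeffZ.
apply: (@form_funM _ _ 1 d) => //.
by apply: form_family_comp => //; exact: dhomog_is_dhomog.
Qed.

Section Jets.
Context {K : numClosedFieldType}.

(** Requiring [g] to be polynomial makes its first-order expansion at [0]
    unique without any topology. *)
Definition jet (g : K -> K) a b :=
  exists q : {poly K}, [/\ forall t, g t = q.[t], q`_0 = a & q`_1 = b].

Lemma jet_ext g h a b : g =1 h -> jet g a b -> jet h a b.
Proof. by move=> gh [q [qE q0 q1]]; exists q; split=> // t; rewrite -gh. Qed.

Lemma jet_affine a b : jet (fun t => a + t * b) a b.
Proof.
exists (a%:P + b%:P * 'X); split=> [t||].
- by rewrite !hornerE mulrC.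
- by rewrite coefD coefMX coefC /= addr0.
- by rewrite coefD coefMX !coefC /= add0r.
Qed.

Lemma jet_cst a : jet (fun=> a) a 0.
Proof. by apply: jet_ext (jet_affine a 0) => t; rewrite mulr0 addr0. Qed.

Lemma jetM g a b h a' b' :
  jet g a b -> jet h a' b' -> jet (fun t => g t * h t) (a * a') (b * a' + a * b').
Proof.
move=> [p [pE p0 p1]] [q [qE q0 q1]]; exists (p * q); split=> [t||].
- by rewrite hornerM pE qE.
- by rewrite coefM big_ord1 p0 q0.
- by rewrite coefM !big_ord_recl big_ord0 /= addr0 p0 q0 p1 q1 addrC.
Qed.

Lemma jet_sum (I : Type) (r : seq I) (P : pred I) (g : I -> K -> K) a b :
  (forall i, jet (g i) (a i) (b i)) ->
  jet (fun t => \sum_(i <- r | P i) g i t)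
    (\sum_(i <- r | P i) a i) (\sum_(i <- r | P i) b i).
Proof.
move=> /choice [q hq]; exists (\sum_(i <- r | P i) q i); split=> [t||].
- by rewrite horner_sum; apply: eq_bigr => i _; case: (hq i).
- by rewrite coef_sum; apply: eq_bigr => i _; case: (hq i).
- by rewrite coef_sum; apply: eq_bigr => i _; case: (hq i).
Qed.

Lemma jetZ c g a b : jet g a b -> jet (fun t => c * g t) (c * a) (c * b).
Proof.
by move=> h; have := jetM (jet_cst c) h; rewrite mul0r add0r.
Qed.

Lemma jet_comp_linear (B : 'M[K]_3) (p : {mpoly K[3]}) m :
  jet (fun t => (p \mPo linear_map (1%:M + t *: B))@_m) p@_m (derive_along B p)@_m.
Proof.
elim/(@mpoly_ring_ind 3 K): p m => [c|i|p q hp hq|p q hp hq] m.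
- apply: (jet_ext (g := fun=> (c%:MP)@_m)) => [t|]; first by rewrite comp_mpolyC.
  rewrite (_ : derive_along B c%:MP = 0) ?mcoeff0; first exact: jet_cst.
  by rewrite /derive_along big1 // => k _; rewrite mderivC mulr0.
- have -> : derive_along B 'X_i = linear_field i B.
    rewrite /derive_along (bigD1 i) //= mderiv_mpolyXU eqxx mulr1 big1 ?addr0 //.
    by move=> k /negPf hk; rewrite mderiv_mpolyXU hk mulr0.
  apply: jet_ext (jet_affine _ _) => t.
  rewrite comp_mpolyXU -tnth_nth tnth_mktuple.
  rewrite -(mcoeffZ t) -mcoeffD; congr (_@_m).
  rewrite scaler_sumr [in LHS](_ : 'X_i = \sum_k (1%:M : 'M[K]_3) i k *: 'X_k).
    rewrite -big_split; apply: eq_bigr => k _ /=.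
    by rewrite !mxE scalerDl scalerA.
  rewrite (bigD1 i) //= mxE eqxx scale1r big1 ?addr0 // => k /negPf hk.
  by rewrite mxE eq_sym hk scale0r.
- rewrite mcoeffD (linearD (derive_along B)) mcoeffD.
  have [a [aE a0 a1]] := hp m; have [b [bE b0 b1]] := hq m.
  exists (a + b); rewrite !coefD a0 b0 a1 b1; split=> // t.
  by rewrite comp_mpolyD mcoeffD hornerD aE bE.
- rewrite derive_alongM mcoeffD !mcoeffM -big_split /=.
  apply: (@jet_ext (fun t => \sum_(k : 'X_{1..3 < (mdeg m).+1, (mdeg m).+1}
      | m == (k.1 + k.2)%MM) (p \mPo linear_map (1%:M + t *: B))@_k.1 *
        (q \mPo linear_map (1%:M + t *: B))@_k.2)).
    by move=> t; rewrite rmorphM /= mcoeffM.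
  by apply: jet_sum => k; apply: jetM.
Qed.

Lemma jet_pullback d (w : one_form K d.+1) (l : {linear one_form K d.+1 -> K^o}) B :
  jet (fun t => l (pullback (1%:M + t *: B) w)) (l w) (l (lie_form w B)).
Proof.
have [c lE] := linear_form_mcoeff l.
apply: jet_ext (fun t => esym (lE _)) _; rewrite !lE.
apply: jet_sum => j; apply: jet_sum => m; apply: jetZ.
pose A i j : K := (1%:M : 'M[K]_3) i j.
have w1 : (w j : {mpoly K[3]})@_m = \sum_i A i j * (w i : {mpoly K[3]})@_m.
  rewrite (bigD1 j) //= /A mxE eqxx mul1r big1 ?addr0 // => i /negPf hi.
  by rewrite mxE hi mul0r.
have w2 : (lie_form w B j : {mpoly K[3]})@_m =
    \sum_i (B i j * (w i : {mpoly K[3]})@_m + A i j * (derive_along B (w i))@_m).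
  rewrite ffunE /= /lie_derivative mcoeffD big_split [RHS]addrC /=; congr (_ + _).
    rewrite (bigD1 j) //= /A mxE eqxx mul1r big1 ?addr0 // => i /negPf hi.
    by rewrite mxE hi mul0r.
  by rewrite raddf_sum; apply: eq_bigr => i _; rewrite /= mcoeffZ.
rewrite w1 w2; apply: (@jet_ext (fun t => \sum_i (A i j + t * B i j) *
    ((w i : {mpoly K[3]}) \mPo linear_map (1%:M + t *: B))@_m)).
  move=> t; rewrite ffunE /= raddf_sum; apply: eq_bigr => i _ /=.
  by rewrite mcoeffZ /A !mxE.
by apply: jet_sum => i; apply: jetM; [exact: jet_affine | exact: jet_comp_linear].
Qed.

(** The partial derivatives at the identity are read off the restrictions of [F]
    to lines, where the pullback is known to first order. *)
Lemma pullback_coordinate n d (w : one_form K d.+1) (B : 'I_n.+1 -> 'M[K]_3)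
    (l : {linear one_form K d.+1 -> K^o}) : B ord0 = 1%:M ->
  exists F : {mpoly K[n.+1]}, [/\ F \is d.+2.-homog,
    forall s, F.@[s] = l (pullback (\sum_i s i *: B i) w) &
    forall j, (mderiv j F).@[fun i => (i == ord0)%:R] = l (lie_form w (B j))].
Proof.
move=> B0; have [|F hF FE] := form_fun_pullback (A := fun s => \sum_i s i *: B i) w l.
  move=> a b; exists (\sum_i B i a b *: 'X_i : {mpoly K[n.+1]}).
    by apply: rpred_sum => i _; apply: dhomogZ; rewrite dhomogX /= mdeg1.
  move=> s; rewrite summxE raddf_sum; apply: eq_bigr => i _.
  by rewrite /= mevalZ mevalXU mxE mulrC.
exists F; split=> // j.
have [q [qE _ q1]] := jet_pullback w l (B j).
pose e i : K := (i == ord0 :> 'I_n.+1)%:R; pose v i : K := (i == j)%:R.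
have LE : on_line e v F = q.
  apply/eqP; rewrite -subr_eq0; apply/negPn/negP => /poly_neq0_eval [t].
  rewrite hornerD hornerN horner_on_line -qE -FE.
  rewrite (_ : \sum_i _ = 1%:M + t *: B j) ?subrr ?eqxx //.
  under eq_bigr do rewrite scalerDl; rewrite big_split /=; congr (_ + _).
    rewrite (bigD1 ord0) //= /e eqxx scale1r B0 big1 ?addr0 // => i /negPf hi.
    by rewrite hi scale0r.
  rewrite (bigD1 j) //= /v eqxx mul1r big1 ?addr0 // => i /negPf hi.
  by rewrite hi mul0r scale0r.
have := deriv_on_line e v F; rewrite LE => /(congr1 (horner^~ 0)).
rewrite horner_coef0 coef_deriv q1 mulr1n horner_sum (bigD1 j) //= => ->.
rewrite hornerM hornerC /v eqxx mul1r horner_on_line big1 ?addr0.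
  by apply: meval_eq => i; rewrite mulr0 addr0.
by move=> i /negPf hi; rewrite hornerM hornerC hi mul0r.
Qed.

End Jets.

Local Open Scope classical_set_scope.

(** * Chains of irreducible closed subsets of an orbit *)

Lemma meval_homogZ (K : fieldType) n (p : {mpoly K[n]}) e c (x : 'I_n -> K) :
  p \is e.-homog -> p.@[fun i => c * x i] = c ^+ e * p.@[x].
Proof.
move=> /dhomogP hp; rewrite !mevalE mulr_sumr !big_seq; apply: eq_bigr => m /hp /= <-.
rewrite mulrCA; congr (_ * _); rewrite mdegE -prodrXr -big_split.
by apply: eq_bigr => i _; rewrite exprMn.
Qed.

Section Orbit.
Context {K : numClosedFieldType} {d : nat}.
Notation V := (one_form K d.+1).
Variables (w : V) (F : projective_space V).
Hypothesis FE : sval F = <[w]>%VS.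

Definition coords (v : V) : 'I_(\dim {:V}) -> K :=
  fun i => coord (vbasis {:V}) i v.

Lemma coords_functional (l : {linear V -> K^o}) :
  exists p : {mpoly K[\dim {:V}]}, p \is 1.-homog /\ forall v, p.@[coords v] = l v.
Proof.
exists (\sum_(i < \dim {:V}) l (vbasis {:V})`_i *: 'X_i); split.
  by apply: rpred_sum => i _; apply: dhomogZ; rewrite dhomogX /= mdeg1.
move=> v; rewrite {2}(coord_vbasis (memvf v)) linear_sum raddf_sum.
by apply: eq_bigr => i _; rewrite /= mevalZ mevalXU [RHS]linearZ /= mulrC.
Qed.

Section Cone.
Context {n : nat} (B : 'I_n.+1 -> 'M[K]_3).
Hypothesis B0 : B ord0 = 1%:M.

Definition span_mx (s : 'I_n.+1 -> K) : 'M[K]_3 := \sum_i s i *: B i.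

Definition span_ideal : set {mpoly K[\dim {:V}]} :=
  [set p | p \is homog mdeg /\ forall s, p.@[coords (pullback (span_mx s) w)] = 0].

(** The closure, in the orbit, of the images of [F] under the invertible
    matrices of the linear span of [B]. *)
Definition orbit_closure : set (projective_space V) :=
  foliation_orbit F `&` vanishing_locus span_ideal.

Lemma closed_in_orbit_closure :
  closed_in zariski_closed (foliation_orbit F) orbit_closure.
Proof.
exists (vanishing_locus span_ideal) => //.
by exists span_ideal => // p [].
Qed.

Lemma meval_span_coords (p : {mpoly K[\dim {:V}]}) :
  exists q : {mpoly K[n.+1]}, forall s, q.@[s] = p.@[coords (pullback (span_mx s) w)].
Proof.
have /choice [G GE] : forall i, exists G : {mpoly K[n.+1]}, forall s,
    G.@[s] = coords (pullback (span_mx s) w) i.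
  move=> i; pose l : {linear V -> K^o} := coord (vbasis {:V}) i.
  by have [G [_ GE _]] := pullback_coordinate w l B0; exists G => s; exact: GE.
exists (p \mPo [tuple G i | i < _]) => s.
by rewrite comp_mpoly_meval; apply: meval_eq => i; rewrite tnth_mktuple GE.
Qed.

Lemma span_mx_ord0 : span_mx (fun i => (i == ord0)%:R) = 1%:M.
Proof.
rewrite /span_mx (bigD1 ord0) // eqxx scale1r B0 big1 => [|i]; first exact: addr0.
by move=> /negPf hi; rewrite hi scale0r.
Qed.

Lemma pullback1 : pullback 1%:M w = w.
Proof.
have L : linear_map (1%:M : 'M[K]_3) = [tuple 'X_i | i < 3].
  apply: eq_from_tnth => i; rewrite !tnth_mktuple (bigD1 i) //= mxE eqxx scale1r.
  by rewrite big1 ?addr0 // => k /negPf hk; rewrite mxE eq_sym hk scale0r.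
apply/ffunP => j; rewrite ffunE; apply: val_inj; rewrite /= /pullback_coef L.
rewrite (bigD1 j) //= mxE eqxx scale1r comp_mpoly_id big1 ?addr0 // => i /negPf hi.
by rewrite mxE hi scale0r.
Qed.

Lemma vector_neq0 : w != 0.
Proof. by have := svalP F; rewrite FE dim_vline; case: (w != 0). Qed.

(** The parameters to avoid are the zeros of a product of nonzero polynomials:
    [q], the determinant, and a coordinate of the pullback. *)
Lemma span_generic_point (q : {mpoly K[n.+1]}) : q != 0 ->
  exists s (G : projective_space V), [/\ q.@[s] != 0, orbit_closure G &
    sval G = <[pullback (span_mx s) w]>%VS].
Proof.
move=> q0; pose e i : K := (i == ord0 :> 'I_n.+1)%:R.
pose M : 'M[{mpoly K[n.+1]}]_3 := \matrix_(a, b) \sum_i B i a b *: 'X_i.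
have DE s : (\det M).@[s] = \det (span_mx s).
  rewrite -det_map_mx; congr (\det _); apply/matrixP => a b.
  rewrite !mxE summxE raddf_sum; apply: eq_bigr => i _.
  by rewrite /= mevalZ mevalXU mxE mulrC.
have D0 : \det M != 0.
  apply: contraTneq (oner_neq0 K) => h; rewrite negbK.
  by rewrite -(det1 K 3) -span_mx_ord0 -DE h meval0.
have [i wi] : exists i, coords w i != 0.
  apply: contrapT => /forallNP h; case/eqP: vector_neq0.
  rewrite (coord_vbasis (memvf w)) big1 // => i _.
  by have /negP/negPn/eqP := h i; rewrite /coords => ->; rewrite scale0r.
have [c cE] := meval_span_coords 'X_i.
have c0 : c != 0.
  apply: contraNneq wi => h.
  by have := cE e; rewrite h meval0 mevalXU span_mx_ord0 pullback1 => <-.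
have [s] := mpoly_neq0_eval (mulf_neq0 (mulf_neq0 q0 D0) c0).
rewrite !mevalM !mulf_eq0 !negb_or DE cE mevalXU => /andP [/andP [hq hD] hc].
have p0 : pullback (span_mx s) w != 0.
  by apply: contraNneq hc => ->; rewrite /coords linear0.
have hG : \dim <[pullback (span_mx s) w]> == 1%N by rewrite dim_vline p0.
exists s, (exist (fun L : {vspace V} => \dim L == 1%N) _ hG); split => //; split.
  exists (span_mx s); first by rewrite unitmxE unitfE.
  by rewrite FE limg_line lfunE.
move=> p [/homogP [k hp] pI] v /vlineP [a ->].
rewrite (_ : p.@[_] = a ^+ k * p.@[coords (pullback (span_mx s) w)]).
  by rewrite pI mulr0.
by rewrite -meval_homogZ //; apply: meval_eq => j; rewrite /coords linearZ.
Qed.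

(** Equations of two closed subsets not containing the closure pull back to
    nonzero polynomials in the parameters, whose product is nonzero. *)
Lemma irreducible_orbit_closure : irreducible zariski_closed orbit_closure.
Proof.
split.
  have [s [G [_ hG _]]] := span_generic_point (oner_neq0 _).
  by exists G.
move=> _ _ [S1 hS1 ->] [S2 hS2 ->] sub.
have H (S : set {mpoly K[\dim {:V}]}) : (forall p, S p -> p \is homog mdeg) ->
    ~ (orbit_closure `<=` vanishing_locus S) ->
    exists p q, [/\ S p, q != 0 & forall s : 'I_n.+1 -> K,
      q.@[s] = p.@[coords (pullback (span_mx s) w)]].
  move=> hS hn; apply: contrapT => hq; apply: hn => G [_ hG] p Sp.
  apply: hG; split; first exact: hS.
  have [q qE] := meval_span_coords p; move=> s; rewrite -qE.
  have [->|q0] := eqVneq q 0; first by rewrite meval0.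
  by case: hq; exists p, q.
apply: contrapT => /not_orP [/(H _ hS1) [p1 [q1 [Sp1 q10 q1E]]]].
move=> /(H _ hS2) [p2 [q2 [Sp2 q20 q2E]]].
have [s [G [hs hG GE]]] := span_generic_point (mulf_neq0 q10 q20).
move: hs; rewrite mevalM mulf_eq0 q1E q2E => /norP [n1 n2].
have vG : pullback (span_mx s) w \in sval G by rewrite GE memv_line.
by case: (sub G hG) => hv; [case/eqP: n1 | case/eqP: n2]; exact: hv.
Qed.

End Cone.

Section Flag.
Context {m : nat} (B : 'I_m.+1 -> 'M[K]_3) (l : 'I_m.+1 -> {linear V -> K^o}).
Hypothesis B0 : B ord0 = 1%:M.
Hypothesis lB : forall i j, l i (lie_form w (B j)) = (i == j)%:R.

Definition flag k (i : 'I_k.+1) := B (inord i).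

Lemma flag0 k : @flag k ord0 = 1%:M.
Proof. by rewrite /flag -B0; congr B; apply: val_inj; rewrite /= inordK. Qed.

Lemma span_flagS k (s : 'I_k.+1 -> K) :
  span_mx (@flag k) s = span_mx (@flag k.+1)
    (fun i => if unlift ord_max i is Some j then s j else 0).
Proof.
rewrite /span_mx [RHS]big_ord_recr /= unlift_none scale0r addr0.
apply: eq_bigr => i _.
by rewrite widen_ord_lift_max liftK /flag /= /bump leqNgt ltn_ord.
Qed.

(** On the span of [k + 1] matrices, [k + 2] of the functionals [l] are
    algebraically dependent by counting monomials. On the span of [k + 2] they
    are independent: their Jacobian matrix at the identity is the unit matrix. *)
Lemma flag_separating k : (k < m)%N -> exists p : {mpoly K[\dim {:V}]},
  span_ideal (@flag k) p /\ ~ span_ideal (@flag k.+1) p.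
Proof.
move=> km; pose l' (i : 'I_k.+2) := l (inord i).
have /choice [G hG] i := pullback_coordinate w (l' i) (flag0 k).
have /choice [H hH] i := pullback_coordinate w (l' i) (flag0 k.+1).
have [|e [P [hP P0 PG]]] := @forms_dependent K k d.+2 [tuple G i | i < k.+2].
  by move=> i; rewrite tnth_mktuple; case: (hG i).
have PH : P \mPo [tuple H i | i < k.+2] != 0.
  apply: contraNneq P0 => hPH; apply/eqP; apply: (jacobian_independent _ hP hPH).
  apply/eqP => /(congr1 (meval (fun i : 'I_k.+2 => (i == ord0)%:R))) /eqP.
  rewrite meval0 -det_map_mx (_ : map_mx _ _ = 1%:M) ?det1 ?oner_eq0 //.
  apply/matrixP => i j; rewrite !mxE tnth_mktuple.
  rewrite /=; case: (hH i) => _ _ ->; rewrite lB; congr (_%:R).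
  rewrite -!val_eqE /= !inordK //; exact: leq_trans (ltn_ord _) _.
have /choice [q hq] i := coords_functional (l' i).
have qE v : (P \mPo [tuple q i | i < k.+2]).@[coords v] = P.@[fun i => l' i v].
  rewrite comp_mpoly_meval; apply: meval_eq => i.
  by rewrite tnth_mktuple; case: (hq i).
exists (P \mPo [tuple q i | i < k.+2]); split.
  split.
    apply/homogP; exists (1 * e)%N; apply: comp_mpoly_homog hP => i.
    by rewrite tnth_mktuple; case: (hq i).
  move=> s; rewrite qE -(meval0 s) -PG comp_mpoly_meval; apply: meval_eq => i.
  by rewrite tnth_mktuple; case: (hG i) => _ ->.
case=> _ hs; have [s] := mpoly_neq0_eval PH; case/negP; apply/eqP.
rewrite -(hs s) qE comp_mpoly_meval; apply: meval_eq => i.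
by rewrite tnth_mktuple; case: (hH i) => _ ->.
Qed.

Lemma flag_proper k : (k < m)%N -> orbit_closure (@flag k) `<` orbit_closure (@flag k.+1).
Proof.
move=> km; split.
  move=> G [OG hG]; split=> // p [hp pI]; apply: hG; split=> // s.
  by rewrite span_flagS pI.
have [p [[hp pI] pI']] := flag_separating km.
have [q qE] := meval_span_coords (flag0 k.+1) p.
have q0 : q != 0.
  by apply/eqP => q0; apply: pI'; split=> // s; rewrite -qE q0 meval0.
have [s [G [hs hG GE]]] := span_generic_point (flag0 k.+1) q0.
move=> /(_ G hG) [_ /(_ p (conj hp pI))].
move=> /(_ (pullback (span_mx (@flag k.+1) s) w)); rewrite GE memv_line => /(_ isT) h.
by move: hs; rewrite qE h eqxx.
Qed.

Theorem orbit_dim_ge (R : realType) :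
  (m%:R%:E <= krull_dim zariski_closed R (foliation_orbit F))%E.
Proof.
apply: ereal_sup_ubound; exists m => //=.
exists (fun k => orbit_closure (@flag k)); split=> k km; last exact: flag_proper.
split; first exact: closed_in_orbit_closure.
exact/irreducible_orbit_closure/flag0.
Qed.

End Flag.
End Orbit.

Theorem proposition2p3 (R : realType) (N : nat) (hN : (2 <= N)%N)
    (F : projective_space (one_form R[i] N.+1)) (hF : foliations N F) :
  (6%:R%:E <= krull_dim zariski_closed R (foliation_orbit F))%E.
Proof.
have [w [FE wP wE]] := hF.
have [B [B0 [l lB]]] := exists_free_lie_forms wE wP hN.
exact: (@orbit_dim_ge _ _ w F FE 6 B l B0 lB R).
Qed.
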